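(* Let $(M,H,J)$ be an almost CR structure of hypersurface type, with associated bundle-valued forms $\omega$, $\nu$, $g$ on $H$ and automorphism $A=g^{-1}\omega$ of $H$. Suppose that $\omega$ and $\nu$ are both non-degenerate at every point of $M$, and that at every point of $M$ none of the eigenvalues of $A$ is real. Then there exists an almost-complex structure $K$ on $H$, uniquely defined by the data $(H,J)$, such that $(H,K)$ makes $M$ a partially integrable CR manifold. Here ''uniquely defined by the data $(H,J)$'' means that there is an assignment $(M,H,J)\mapsto K$, defined on all almost CR structures of hypersurface type $(M,H,J)$ for which $\omega$ and $\nu$ are both non-degenerate at every point of $M$ and none of the eigenvalues of $A=g^{-1}\omega$ is real at any point of $M$, which involves no further choices: whenever $\varphi:M\to M'$ is a diffeomorphism with $d\varphi(H)=H'$ and $d\varphi\circ J=J'\circ d\varphi$ on $H$, the assigned structures satisfy $d\varphi\circ K=K'\circ d\varphi$ on $H$.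
   Context: An almost CR structure of hypersurface type $(M,H,J)$ consists of: a manifold $M$ of dimension $1+2n$; a distribution $H\subset TM$ of rank $2n$, with its associated (possibly degenerate) form $\omega\in\Gamma(\wedge^2H^*\otimes(TM/H))$ induced by the Lie bracket, $\omega(X,Y)=[X,Y] \bmod H$ for $X,Y\in\Gamma(H)$; and an almost-complex structure $J$ on $H$ (a bundle endomorphism of $H$ with $J^2=-\mathrm{Id}$) such that the form $$\nu(X,Y)=\tfrac12\big(\omega(X,Y)+\omega(JX,JY)\big)$$ is non-degenerate. Then $\nu(JX,JY)=\nu(X,Y)$, and $\nu$ defines a $TM/H$-valued metric (non-degenerate symmetric form) on $H$ by $g(X,Y)=\nu(X,JY)$. The endomorphism $A=g^{-1}\omega$ of $H$ is defined by $g(AX,Y)=\omega(X,Y)$; it does not depend on any trivialisation of $TM/H$, and it is an automorphism when $\omega$ is non-degenerate. Eigenvalues of $A$ are the complex eigenvalues of $A_x$ acting on $H_x\otimes\mathbb{C}$. A partially integrable CR manifold is an almost CR structure of hypersurface type $(M,H,K)$ for which the form $\nu$ built from $\omega$ and $K$ equals $\omega$, i.e. $\omega(KX,KY)=\omega(X,Y)$ for all $X,Y\in\Gamma(H)$ (with $\omega$ non-degenerate). *)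

(* Defs.v *)
From HB Require Import structures.
From mathcomp Require Import all_boot all_order all_algebra.
From mathcomp Require Import all_classical all_reals all_analysis.
From mathcomp Require Import complex.

Set Implicit Arguments.
Unset Strict Implicit.
Unset Printing Implicit Defensive.

Import Order.TTheory GRing.Theory Num.Theory.
Import numFieldNormedType.Exports.

Local Open Scope classical_set_scope.
Local Open Scope ring_scope.

(** * Smooth manifolds

    Vectors are rows and linear maps act on the right: the image of [v] under
    the endomorphism [A] is [v *m A]. *)

(* Only used on open sets [U]: [f] is C^(k+1) iff it is differentiable and each
   of its directional derivatives is C^k. *)
Fixpoint Ck (R : realType) (d e : nat) (k : nat) (U : set 'rV[R]_d)
    (f : 'rV[R]_d -> 'rV[R]_e) : Prop :=
  match k with
  | 0 => forall x, U x -> {for x, continuous f}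
  | k'.+1 => (forall x, U x -> differentiable f x) /\
             (forall v, Ck k' U (fun x => 'D_v f x))
  end.

Definition smooth_on (R : realType) (d e : nat) (U : set 'rV[R]_d)
    (f : 'rV[R]_d -> 'rV[R]_e) : Prop := forall k, Ck k U f.

(* A homeomorphism from the open set [cdom] of [T] onto an open set of R^d; the
   values of [cmap] and [cinv] outside these two sets are junk. *)
Record chart (R : realType) (T : topologicalType) (d : nat) := Chart {
  cdom : set T;
  cmap :> T -> 'rV[R]_d;
  cinv : 'rV[R]_d -> T;
  cdom_open : open cdom;
  ccod_open : open (cmap @` cdom);
  cmapK : forall x, cdom x -> cinv (cmap x) = x;
  cmap_continuous : forall x, cdom x -> {for x, continuous cmap};
  cinv_continuous : forall y, (cmap @` cdom) y -> {for y, continuous cinv}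
}.

(* As part of the data, each point [x] has a preferred chart [chart_at x]. It
   serves only to name tangent vectors: T_x M is 'rV[R]_d, a vector being given
   by its components in the chart [chart_at x]. *)
Record manifold (R : realType) (d : nat) := Manifold {
  carrier :> topologicalType;
  manifold_hausdorff : hausdorff_space carrier;
  manifold_second_countable : @second_countable carrier;
  atlas : set (chart R carrier d);
  atlas_compatible : forall c c', atlas c -> atlas c' ->
    smooth_on (c @` (cdom c `&` cdom c')) (c' \o cinv c);
  chart_at : carrier -> chart R carrier d;
  chart_at_atlas : forall x, atlas (chart_at x);
  chart_at_dom : forall x, cdom (chart_at x) x
}.

Definition smooth_map (R : realType) (d e : nat) (M : manifold R d)
    (N : manifold R e) (phi : M -> N) : Prop :=
  continuous phi /\
  forall (c : chart R M d) (c' : chart R N e), atlas c -> atlas c' ->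
    smooth_on (c @` (cdom c `&` phi @^-1` cdom c')) (c' \o phi \o cinv c).

Definition diffeomorphism (R : realType) (d : nat) (M N : manifold R d)
    (phi : M -> N) : Prop :=
  smooth_map phi /\
  exists psi : N -> M, [/\ smooth_map psi, cancel phi psi & cancel psi phi].

(* The matrix of d(phi)_x : T_x M -> T_(phi x) N. *)
Definition tangent_map (R : realType) (d e : nat) (M : manifold R d)
    (N : manifold R e) (phi : M -> N) (x : M) : 'M[R]_(d, e) :=
  'J (chart_at (phi x) \o phi \o cinv (chart_at x)) (chart_at x x).

(** * Vector fields and distributions *)

(* The components, in the chart [c], of the vector field [X], as a function of
   the coordinates [y]. *)
Definition local_rep (R : realType) (d : nat) (M : manifold R d)
    (c : chart R M d) (X : M -> 'rV[R]_d) (y : 'rV[R]_d) : 'rV[R]_d :=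
  let x := cinv c y in X x *m 'J (c \o cinv (chart_at x)) (chart_at x x).

Definition smooth_vf (R : realType) (d : nat) (M : manifold R d) (U : set M)
    (X : M -> 'rV[R]_d) : Prop :=
  forall c : chart R M d, atlas c ->
    smooth_on (c @` (U `&` cdom c)) (local_rep c X).

Definition lie_bracket (R : realType) (d : nat) (M : manifold R d)
    (X Y : M -> 'rV[R]_d) (x : M) : 'rV[R]_d :=
  let c := chart_at x in
  local_rep c X (c x) *m 'J (local_rep c Y) (c x)
  - local_rep c Y (c x) *m 'J (local_rep c X) (c x).

(* A field of subspaces of the tangent spaces is given by matrices, [H x] being
   the row space of the matrix; smooth sections over an open set [U]. *)
Definition smooth_section (R : realType) (d : nat) (M : manifold R d)
    (H : M -> 'M[R]_d) (U : set M) (X : M -> 'rV[R]_d) : Prop :=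
  smooth_vf U X /\ forall x, U x -> (X x <= H x)%MS.

Definition distribution (R : realType) (d : nat) (M : manifold R d) (r : nat)
    (H : M -> 'M[R]_d) : Prop :=
  (forall x, \rank (H x) = r) /\
  forall x, exists (U : set M) (F : 'I_r -> M -> 'rV[R]_d),
    [/\ open_nbhs x U,
        forall i, smooth_section H U (F i) &
        forall y, U y -> (H y <= \matrix_(i < r) F i y)%MS].

(* Only the restriction of [J x] to [H x] is meaningful. *)
Definition almost_complex (R : realType) (d : nat) (M : manifold R d)
    (H J : M -> 'M[R]_d) : Prop :=
  [/\ forall x, stablemx (H x) (J x),
      forall U X, open U -> smooth_section H U X ->
        smooth_vf U (fun x => X x *m J x) &
      forall x (v : 'rV[R]_d), (v <= H x)%MS -> v *m J x *m J x = - v].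

(** * The forms omega, nu, g and the endomorphism A

    An element of T_x M / H_x is given by a representative in T_x M, so that
    equality in the quotient is congruence modulo [H x]. A bundle-valued form at
    [x] is a function of two tangent vectors, meaningful on [H x] only. *)

Definition eq_mod (R : realType) (d : nat) (h : 'M[R]_d) (u v : 'rV[R]_d) : bool :=
  (u - v <= h)%MS.

(* For skew-symmetric and for symmetric forms the left kernel is the kernel. *)
Definition nondegenerate_form (R : realType) (d : nat) (h : 'M[R]_d)
    (b : 'rV[R]_d -> 'rV[R]_d -> 'rV[R]_d) : Prop :=
  forall u : 'rV[R]_d, (u <= h)%MS ->
    (forall v : 'rV[R]_d, (v <= h)%MS -> eq_mod h (b u v) 0) -> u = 0.

(* [X, Y]_x for an arbitrary choice of local sections X, Y of H extending [u]
   and [v]; modulo [H x] the choice is irrelevant. *)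
Definition omega (R : realType) (d : nat) (M : manifold R d) (H : M -> 'M[R]_d)
    (x : M) (u v : 'rV[R]_d) : 'rV[R]_d :=
  xget 0 [set w | exists (U : set M) (X Y : M -> 'rV[R]_d),
    [/\ open_nbhs x U, smooth_section H U X, smooth_section H U Y,
        X x = u /\ Y x = v & w = lie_bracket X Y x]].

Definition nu (R : realType) (d : nat) (M : manifold R d) (H J : M -> 'M[R]_d)
    (x : M) (u v : 'rV[R]_d) : 'rV[R]_d :=
  2^-1 *: (omega H x u v + omega H x (u *m J x) (v *m J x)).

Definition metric (R : realType) (d : nat) (M : manifold R d)
    (H J : M -> 'M[R]_d) (x : M) (u v : 'rV[R]_d) : 'rV[R]_d :=
  nu H J x u (v *m J x).

(* When nu is non-degenerate, the endomorphism [A] of [H x] with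
   g(A u, v) = omega(u, v) exists and is unique as an endomorphism of [H x]. *)
Definition endoA (R : realType) (d : nat) (M : manifold R d)
    (H J : M -> 'M[R]_d) (x : M) : 'M[R]_d :=
  xget 0 [set A | stablemx (H x) A /\
    forall u v : 'rV[R]_d, (u <= H x)%MS -> (v <= H x)%MS ->
      eq_mod (H x) (metric H J x (u *m A) v) (omega H x u v)].

Definition complexify (R : realType) (m d : nat) (A : 'M[R]_(m, d)) :
  'M[R[i]]_(m, d) := map_mx (real_complex R) A.

(* [l] is an eigenvalue of [A] acting on the complexification of [h]. *)
Definition eigenvalue_on (R : realType) (d : nat) (h A : 'M[R]_d) (l : R[i]) :
    Prop :=
  exists z : 'rV[R[i]]_d,
    [/\ z != 0, (z <= complexify h)%MS & z *m complexify A = l *: z].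

(** * CR structures *)

Definition almost_CR (R : realType) (n : nat) (M : manifold R n.*2.+1)
    (H J : M -> 'M[R]_(n.*2.+1)) : Prop :=
  [/\ distribution n.*2 H, almost_complex H J &
      forall x, nondegenerate_form (H x) (nu H J x)].

Definition partially_integrable_CR (R : realType) (n : nat)
    (M : manifold R n.*2.+1) (H K : M -> 'M[R]_(n.*2.+1)) : Prop :=
  [/\ almost_CR H K,
      forall x, nondegenerate_form (H x) (omega H x) &
      forall x (u v : 'rV[R]_(n.*2.+1)), (u <= H x)%MS -> (v <= H x)%MS ->
        eq_mod (H x) (nu H K x u v) (omega H x u v)].

Definition regular_almost_CR (R : realType) (n : nat) (M : manifold R n.*2.+1)
    (H J : M -> 'M[R]_(n.*2.+1)) : Prop :=
  [/\ almost_CR H J,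
      forall x, nondegenerate_form (H x) (omega H x) &
      forall x l, eigenvalue_on (H x) (endoA H J x) l -> l \isn't Num.real].

Definition maps_distribution (R : realType) (d : nat) (M M' : manifold R d)
    (phi : M -> M') (H : M -> 'M[R]_d) (H' : M' -> 'M[R]_d) : Prop :=
  forall x, (H x *m tangent_map phi x == H' (phi x))%MS.

Definition intertwines (R : realType) (d : nat) (M M' : manifold R d)
    (phi : M -> M') (H : M -> 'M[R]_d) (J : M -> 'M[R]_d)
    (J' : M' -> 'M[R]_d) : Prop :=
  forall x (v : 'rV[R]_d), (v <= H x)%MS ->
    v *m J x *m tangent_map phi x = v *m tangent_map phi x *m J' (phi x).

(* Main.v *)
(* At each point put [A = g^-1 omega]. It is skew for the symmetric form [g], so
   that its characteristic polynomial chi is even; having no real root, chi factors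
   as [p * conj p], where [p = a + i b] is monic with all its roots in the upper
   half plane. Since [a^2 + b^2 = chi], the Cayley-Hamilton theorem shows that
   [K = - a(A) / b(A)] satisfies [K^2 = -1]; it commutes with [A], and it is skew for
   [g] by the parity of chi, hence [omega(K u, K v) = omega(u, v)]. No choice enters,
   so K is natural.

   For the smoothness of K: the roots of [p] are bounded by chi and stay in the upper
   half plane, so by compactness and by uniqueness of the factorisation [p] depends
   continuously on chi; the identity
   [chi1 - chi0 = (a1 - a0)(a1 + a0) + (b1 - b0)(b1 + b0)], whose right hand side is
   invertible in [(a1 - a0, b1 - b0)] because [a] and [b] are coprime, then improves
   continuity to smoothness.

   Modulo H, the bracket of two sections of H is the exterior derivative of a
   1-form annihilating H, evaluated on them. This shows at once that omega is
   tensorial, that it can be computed in any chart, and that it is natural under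
   diffeomorphisms. *)

Require Import Defs.
From HB Require Import structures.
From mathcomp Require Import all_boot all_order all_algebra.
From mathcomp Require Import all_classical all_reals all_analysis.
From mathcomp Require Import complex ring lra.
Set Implicit Arguments.
Unset Strict Implicit.
Unset Printing Implicit Defensive.
Import Order.TTheory GRing.Theory Num.Theory.
Import numFieldNormedType.Exports.
Local Open Scope classical_set_scope.
Local Open Scope ring_scope.

(** * Finite differentiability and its closure properties *)

(** Single roots of chi are not smooth functions of chi where they collide, so K cannot be built
    eigenvalue by eigenvalue: only the product p over all roots in the upper half plane is followed,
    and the quadratic equation for its real and imaginary parts takes the place of an implicit
    function theorem.

    Tangent vectors at a point are written in the preferred chart of that point, which varies with
    no regularity. Fields are therefore compared in one fixed chart through the Jacobians [mjac],
    and H is followed there by three smooth objects: a frame, a 1-form [theta] with kernel H, and a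
    matrix [L] that reads off coordinates in the frame. Any such [theta] will do: rescaling it
    multiplies the matrices of omega and g by the same factor and leaves A unchanged.

    Naturality is obtained by pulling a frame at [phi x] back to [x]. The forms and J then have the
    same matrices at both points, so neither A nor K ever has to be transported. *)

Lemma near_open (T : topologicalType) (U P : set T) (x : T) :
  open U -> U x -> U `<=` P -> \forall y \near x, P y.
Proof. by move=> Uo Ux UP; apply: (filterS UP); exact: open_nbhs_nbhs. Qed.

Lemma near_eq_continuous_at (S T : topologicalType) (f g : S -> T) (x : S) :
  (\near x, f x = g x) -> {for x, continuous f} -> {for x, continuous g}.
Proof.
move=> fg; rewrite /prop_for /continuous_at -(nbhs_singleton fg).
by apply: cvg_trans; apply: (@near_eq_cvg _ _ (nbhs x)) => //; exact: fg.
Qed.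

Section NearEq.
Context {R : realType} {V W : normedModType R}.

Lemma near_translate (P : set V) (x : V) :
  (\forall y \near x, P y) -> \forall y \near (0 : V), P (y + x).
Proof. by rewrite (near_shift 0) subr0. Qed.

(** The second hypothesis says that h is o(y) at x, so 0 is a differential by uniqueness. It serves
    for functions that vanish near x and for products of two small increments. *)
Lemma differentiable_small (h : V -> W) (x : V) : h x = 0 ->
  (forall e : R, 0 < e -> \forall y \near (0 : V), `|h (y + x)| <= e * `|y|) ->
  differentiable h x.
Proof.
move=> hx hs.
have ho : h \o shift x = cst (h x) + (0 : V -> W) +o_ 0 id.
  apply/eqaddoP => e /hs; rewrite addr0 hx; apply: filterS => y.
  by rewrite !fctE /= subr0.
have dh : 'd h x = 0 :> (V -> W).
  by apply: (@diff_unique _ _ _ h (@GRing.null_fun V W) x) => //; exact: cst_continuous.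
by apply/diff_locallyP; rewrite dh; split => //; exact: cst_continuous.
Qed.

Lemma near_eq_differentiable (f g : V -> W) (x : V) :
  (\near x, f x = g x) -> differentiable f x -> differentiable g x.
Proof.
move=> fg df; have -> : g = f + (g - f) by apply/funext => y; rewrite !fctE addrC subrK.
apply: differentiableD => //; apply: differentiable_small.
  by rewrite !fctE (nbhs_singleton fg) subrr.
move=> e e0.
apply: filterS (near_translate fg) => y fgy; rewrite !fctE fgy subrr normr0.
by rewrite mulr_ge0// ltW.
Qed.

End NearEq.

Section ScalarSmooth.
Context {R : realType} {d : nat}.
Local Notation V := 'rV[R]_d.
Implicit Types (U : set V) (f g : V -> R) (v x : V).

(** Scalar counterpart of [Ck]: products and inverses are available in R, and matrices and
    polynomials reduce to it entry by entry. *)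
Fixpoint Cks k U f : Prop :=
  match k with
  | 0 => forall x, U x -> {for x, continuous f}
  | k'.+1 => (forall x, U x -> differentiable f x) /\
             (forall v, Cks k' U (fun x => 'D_v f x))
  end.

Lemma Cks_eq k U f g : open U -> (forall x, U x -> f x = g x) ->
  Cks k U f -> Cks k U g.
Proof.
move=> Uo; elim: k f g => [|k IH] f g fg /=.
  move=> cf x Ux; apply: near_eq_continuous_at (cf x Ux).
  exact: near_open Uo Ux fg.
have Ufg x : U x -> \near x, f x = g x.
  by move=> Ux; exact: near_open Uo Ux fg.
move=> [df Df]; split=> [x Ux|v].
  exact: near_eq_differentiable (Ufg x Ux) (df x Ux).
by apply: IH (Df v) => x Ux; apply: near_eq_derive; exact: Ufg.
Qed.

Lemma Cks_sub k U U' f : U' `<=` U -> Cks k U f -> Cks k U' f.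
Proof.
move=> sU; elim: k f => [|k IH] f /=; first by move=> cf x /sU /cf.
by move=> [df Df]; split=> [x /sU /df//|v]; exact/IH/Df.
Qed.

Lemma CksW k U f : Cks k.+1 U f -> Cks k U f.
Proof.
elim: k f => [|k IH] f /=.
  by move=> [df _] x /df; exact: differentiable_continuous.
by move=> [df Df]; split=> // v; apply/IH/Df.
Qed.

(** [Cks] is a conjunction of conditions at single points on globally defined functions, so it glues
    over any family of sets covering U. *)
Lemma Cks_local k U f :
  (forall x, U x -> exists2 U', U' x & Cks k U' f) -> Cks k U f.
Proof.
elim: k f => [|k IH] f /= lf.
  by move=> x /lf[U' Ux]; apply.
split=> [x /lf[U' Ux []]|v]; first by move=> + _; apply.
by apply: IH => x /lf[U' Ux [_ Df]]; exists U'.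
Qed.

Lemma Cks_differentiable k U f x : Cks k.+1 U f -> U x -> differentiable f x.
Proof. by move=> [+ _]; apply. Qed.

Lemma Cks_derive k U f v : Cks k.+1 U f -> Cks k U (fun x => 'D_v f x).
Proof. by case=> _; apply. Qed.

Lemma Cks_cst k U (a : R) : Cks k U (fun=> a).
Proof.
elim: k a => [|k IH] a /=; first by move=> x _; exact: cst_continuous.
split=> [x _|v]; first exact: differentiable_cst.
suff -> : (fun x => 'D_v (fun _ : V => a) x) = (fun=> 0) by exact: IH.
by apply/funext => x; exact: derive_cst.
Qed.

Lemma CksD k U f g : open U -> Cks k U f -> Cks k U g ->
  Cks k U (fun x => f x + g x).
Proof.
move=> Uo; elim: k f g => [|k IH] f g /=.
  by move=> cf cg x Ux; apply: (@continuousD _ _ _ f g); [exact: cf|exact: cg].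
move=> [df Df] [dg Dg]; split=> [x Ux|v].
  by apply: differentiableD; [exact: df|exact: dg].
apply: (Cks_eq Uo _ (IH _ _ (Df v) (Dg v))) => x Ux.
by rewrite (@deriveD _ _ _ f g)//; apply: diff_derivable; [exact: df|exact: dg].
Qed.

Lemma CksM k U f g : open U -> Cks k U f -> Cks k U g ->
  Cks k U (fun x => f x * g x).
Proof.
move=> Uo; elim: k f g => [|k IH] f g.
  by move=> cf cg x Ux; apply: (@continuousM _ _ f g); [exact: cf|exact: cg].
move=> sf sg; case: (sf) (sg) => [df Df] [dg Dg]; split=> [x Ux|v].
  by apply: differentiableM; [exact: df|exact: dg].
apply: (Cks_eq Uo _ (CksD Uo (IH _ _ (CksW sf) (Dg v)) (IH _ _ (CksW sg) (Df v)))).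
move=> x Ux.
by rewrite (@deriveM _ _ f g)//; apply: diff_derivable; [exact: df|exact: dg].
Qed.

Lemma CksV k U f : open U -> (forall x, U x -> f x != 0) -> Cks k U f ->
  Cks k U (fun x => (f x)^-1).
Proof.
move=> Uo f0; elim: k => [|k IH] sf.
  by move=> x Ux; apply: (@continuousV _ _ f); [exact: f0|exact: sf].
(* The derivative of 1/f is - (1/f)^2 f', and 1/f is already C^k by induction. *)
have sV := IH (CksW sf); case: sf => df Df; split=> [x Ux|v].
  by apply: differentiableV; [exact: df|exact: f0].
apply: (Cks_eq Uo _ (CksM Uo (Cks_cst k U (-1))
          (CksM Uo (CksM Uo sV sV) (Df v)))) => x Ux.
rewrite (@deriveV _ _ f) ?f0//; last by apply: diff_derivable; exact: df.
by rewrite /GRing.scale/= mulN1r mulNr expr2 invfM.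
Qed.

Section SmoothClosure.
Variables (k : nat) (U : set V).
Hypothesis Uo : open U.

Lemma CksN f : Cks k U f -> Cks k U (fun x => - f x).
Proof.
move=> sf; apply: (Cks_eq Uo _ (CksM Uo (Cks_cst k U (-1)) sf)) => x _.
by rewrite mulN1r.
Qed.

Lemma Cks_sum (I : Type) (s : seq I) (P : pred I) (F : I -> V -> R) :
  (forall i, P i -> Cks k U (F i)) -> Cks k U (fun x => \sum_(i <- s | P i) F i x).
Proof.
move=> sF; elim: s => [|i s IH].
  by apply: (Cks_eq Uo _ ((Cks_cst k U) 0)) => x _; rewrite big_nil.
have [Pi|Pi] := boolP (P i); last first.
  by apply: (Cks_eq Uo _ IH) => x _; rewrite big_cons (negbTE Pi).
by apply: (Cks_eq Uo _ (CksD Uo (sF i Pi) IH)) => x _; rewrite big_cons Pi.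
Qed.

Lemma Cks_prod (I : Type) (s : seq I) (P : pred I) (F : I -> V -> R) :
  (forall i, P i -> Cks k U (F i)) -> Cks k U (fun x => \prod_(i <- s | P i) F i x).
Proof.
move=> sF; elim: s => [|i s IH].
  by apply: (Cks_eq Uo _ ((Cks_cst k U) 1)) => x _; rewrite big_nil.
have [Pi|Pi] := boolP (P i); last first.
  by apply: (Cks_eq Uo _ IH) => x _; rewrite big_cons (negbTE Pi).
by apply: (Cks_eq Uo _ (CksM Uo (sF i Pi) IH)) => x _; rewrite big_cons Pi.
Qed.

Definition smmx m n (A : V -> 'M[R]_(m, n)) : Prop :=
  forall i j, Cks k U (fun x => A x i j).

Lemma smmx_eq m n (A B : V -> 'M[R]_(m, n)) :
  (forall x, U x -> A x = B x) -> smmx A -> smmx B.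
Proof. by move=> AB sA i j; apply: (Cks_eq Uo _ (sA i j)) => x /AB->. Qed.

Lemma smmx_cst m n (A : 'M[R]_(m, n)) : smmx (fun=> A).
Proof. by move=> i j; exact: Cks_cst. Qed.

Lemma smmxD m n (A B : V -> 'M[R]_(m, n)) :
  smmx A -> smmx B -> smmx (fun x => A x + B x).
Proof.
move=> sA sB i j; apply: (Cks_eq Uo _ (CksD Uo (sA i j) (sB i j))) => x _.
by rewrite mxE.
Qed.

Lemma smmxN m n (A : V -> 'M[R]_(m, n)) : smmx A -> smmx (fun x => - A x).
Proof.
by move=> sA i j; apply: (Cks_eq Uo _ (CksN (sA i j))) => x _; rewrite mxE.
Qed.

Lemma smmxZ m n (a : V -> R) (A : V -> 'M[R]_(m, n)) :
  Cks k U a -> smmx A -> smmx (fun x => a x *: A x).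
Proof.
by move=> sa sA i j; apply: (Cks_eq Uo _ (CksM Uo sa (sA i j))) => x _; rewrite mxE.
Qed.

Lemma smmxM m n p (A : V -> 'M[R]_(m, n)) (B : V -> 'M[R]_(n, p)) :
  smmx A -> smmx B -> smmx (fun x => A x *m B x).
Proof.
move=> sA sB i j.
apply: (Cks_eq Uo (f := fun x => \sum_l A x i l * B x l j)).
  by move=> x _; rewrite mxE.
by apply: Cks_sum => l _; apply: (CksM Uo); [exact: sA|exact: sB].
Qed.

Lemma smmx_tr m n (A : V -> 'M[R]_(m, n)) : smmx A -> smmx (fun x => (A x)^T).
Proof. by move=> sA i j; apply: (Cks_eq Uo _ (sA j i)) => x _; rewrite mxE. Qed.

Lemma Cks_det n (A : V -> 'M[R]_n) : smmx A -> Cks k U (fun x => \det (A x)).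
Proof.
move=> sA; rewrite /determinant; apply: Cks_sum => s _; apply: (CksM Uo).
  exact: Cks_cst.
by apply: Cks_prod => i _; exact: sA.
Qed.

(** Cramer's rule: the entries are cofactors divided by the determinant. *)
Lemma smmx_inv n (A : V -> 'M[R]_n) : (forall x, U x -> A x \in unitmx) ->
  smmx A -> smmx (fun x => invmx (A x)).
Proof.
move=> uA sA i j.
apply: (Cks_eq Uo (f := fun x => (\det (A x))^-1 *
    ((-1) ^+ (j + i) * \det (row' j (col' i (A x)))))).
  by move=> x Ux; rewrite /invmx uA// !mxE.
apply: (CksM Uo).
  apply: (CksV Uo); last exact: Cks_det.
  by move=> x /uA; rewrite unitmxE unitfE.
apply: (CksM Uo); first exact: Cks_cst.
by apply: Cks_det => l m; apply: (Cks_eq Uo _ (sA (lift j l) (lift i m))) => x _;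
  rewrite !mxE.
Qed.

Definition smpoly (p : V -> {poly R}) : Prop := forall i, Cks k U (fun x => (p x)`_i).

Lemma smpoly_eq (p q : V -> {poly R}) :
  (forall x, U x -> p x = q x) -> smpoly p -> smpoly q.
Proof. by move=> pq sp i; apply: (Cks_eq Uo _ (sp i)) => x /pq->. Qed.

Lemma smpoly_cst (p : {poly R}) : smpoly (fun=> p).
Proof. by move=> i; exact: Cks_cst. Qed.

Lemma smpolyC f : Cks k U f -> smpoly (fun x => (f x)%:P).
Proof.
move=> sf [|i].
  by apply: (Cks_eq Uo _ sf) => x _; rewrite coefC.
by apply: (Cks_eq Uo _ ((Cks_cst k U) 0)) => x _; rewrite coefC.
Qed.

Lemma smpolyD (p q : V -> {poly R}) :
  smpoly p -> smpoly q -> smpoly (fun x => p x + q x).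
Proof.
by move=> sp sq i; apply: (Cks_eq Uo _ (CksD Uo (sp i) (sq i))) => x _; rewrite coefD.
Qed.

Lemma smpolyN (p : V -> {poly R}) : smpoly p -> smpoly (fun x => - p x).
Proof.
by move=> sp i; apply: (Cks_eq Uo _ (CksN (sp i))) => x _; rewrite coefN.
Qed.

Lemma smpolyM (p q : V -> {poly R}) :
  smpoly p -> smpoly q -> smpoly (fun x => p x * q x).
Proof.
move=> sp sq i.
apply: (Cks_eq Uo (f := fun x => \sum_(j < i.+1) (p x)`_j * (q x)`_(i - j))).
  by move=> x _; rewrite coefM.
by apply: Cks_sum => l _; apply: (CksM Uo); [exact: sp|exact: sq].
Qed.

Lemma smpoly_sum (I : Type) (s : seq I) (P : pred I) (F : I -> V -> {poly R}) :
  (forall i, P i -> smpoly (F i)) -> smpoly (fun x => \sum_(i <- s | P i) F i x).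
Proof.
move=> sF i.
apply: (Cks_eq Uo (f := fun x => \sum_(j <- s | P j) (F j x)`_i)).
  by move=> x _; rewrite coef_sum.
by apply: Cks_sum => j Pj; exact: sF.
Qed.

Lemma smpoly_prod (I : Type) (s : seq I) (P : pred I) (F : I -> V -> {poly R}) :
  (forall i, P i -> smpoly (F i)) ->
  smpoly (fun x => \prod_(i <- s | P i) F i x).
Proof.
move=> sF; elim: s => [|i s IH].
  by apply: (smpoly_eq _ (smpoly_cst 1)) => x _; rewrite big_nil.
have [Pi|Pi] := boolP (P i); last first.
  by apply: (smpoly_eq _ IH) => x _; rewrite big_cons (negbTE Pi).
by apply: (smpoly_eq _ (smpolyM (sF i Pi) IH)) => x _; rewrite big_cons Pi.
Qed.

Lemma smpoly_char_poly n (A : V -> 'M[R]_n) :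
  smmx A -> smpoly (fun x => char_poly (A x)).
Proof.
move=> sA.
have sE i j : smpoly (fun x => char_poly_mx (A x) i j).
  suff H : smpoly (fun x => ('X *+ (i == j)) - (A x i j)%:P).
    by apply: smpoly_eq H => x _; rewrite !mxE.
  apply: smpolyD; first exact: smpoly_cst.
  by apply/smpolyN/smpolyC/sA.
rewrite /char_poly /determinant; apply: smpoly_sum => s _.
apply: smpolyM; first exact: smpoly_cst.
by apply: smpoly_prod => i _; exact: sE.
Qed.

(** The degree bound N, uniform on U, turns the evaluation into a sum of fixed length. *)
Lemma smmx_horner n (A : V -> 'M[R]_n.+1) (p : V -> {poly R}) (N : nat) :
  (forall x, U x -> (size (p x) <= N)%N) -> smmx A -> smpoly p ->
  smmx (fun x => horner_mx (A x) (p x)).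
Proof.
move=> sz sA sp.
have sX (l : nat) : smmx (fun x => A x ^+ l).
  elim: l => [|l IH]; first exact: smmx_cst.
  by apply: (smmx_eq _ (smmxM sA IH)) => x _; rewrite exprS.
apply: (smmx_eq (A := fun x => \sum_(l < N) (p x)`_l *: A x ^+ l)).
  move=> x Ux; rewrite {2}(_ : p x = \sum_(l < N) (p x)`_l *: 'X^l).
    by rewrite raddf_sum/=; apply: eq_bigr => l _; rewrite linearZ/= rmorphXn/= horner_mx_X.
  by rewrite -poly_def -{1}(take_poly_id (sz x Ux)).
move=> i j.
apply: (Cks_eq Uo (f := fun x => \sum_(l < N) ((p x)`_l *: A x ^+ l) i j)).
  by move=> x _; rewrite summxE.
by apply: Cks_sum => l _; apply: smmxZ.
Qed.

End SmoothClosure.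

Lemma smmx_sub k U U' m n (A : V -> 'M[R]_(m, n)) :
  U' `<=` U -> smmx k U A -> smmx k U' A.
Proof. by move=> sU sA i j; exact: Cks_sub (sA i j). Qed.

Lemma smmx_local k U m n (A : V -> 'M[R]_(m, n)) :
  (forall x, U x -> exists2 U', U' x & smmx k U' A) -> smmx k U A.
Proof.
by move=> sA i j; apply: Cks_local => x /sA[U' Ux sA']; exists U'.
Qed.

Lemma open_neq0 U f : open U -> Cks 0 U f -> open (U `&` [set x | f x != 0]).
Proof.
move=> Uo cf; rewrite openE => x [Ux fx0].
have n0 : nbhs (f x) [set y | y != 0] by apply: open_nbhs_nbhs; split => //; exact: open_neq.
apply: (@filterI _ (nbhs x) _ _ _ _ (cf x Ux _ n0)).
exact: open_nbhs_nbhs.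
Qed.


End ScalarSmooth.

(** * Entrywise calculus of matrix-valued maps *)

Section MatrixCalculus.
Context {R : realType}.

Lemma cvg_mx (T : Type) (F : set_system T) {FF : Filter F} m n
    (f : T -> 'M[R]_(m, n)) (l : 'M[R]_(m, n)) :
  (forall i j, f x i j @[x --> F] --> l i j) -> f @ F --> l.
Proof.
move=> fl A [P lP PA].
suff FP : F [set t | forall i j, P i j (f t i j)].
  by apply: (@filterS _ F FF _ _ _ FP) => t /PA.
apply: (@filter_forall _ _ (fun i t => forall j, P i j (f t i j))) => i.
apply: (@filter_forall _ _ (fun j t => P i j (f t i j))) => j.
by apply: (fl i j); exact: lP.
Qed.

Lemma cvg_mx_coord (T : Type) (F : set_system T) {FF : Filter F} m n
    (f : T -> 'M[R]_(m, n)) (l : 'M[R]_(m, n)) i j :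
  f @ F --> l -> f x i j @[x --> F] --> l i j.
Proof.
move=> fl.
exact: (cvg_comp f (fun A : 'M[R]_(m, n) => A i j) fl (@coord_continuous _ _ _ i j l)).
Qed.

Lemma continuous_mxP (T : topologicalType) m n (f : T -> 'M[R]_(m, n)) x :
  {for x, continuous f} <-> forall i j, {for x, continuous (fun y => f y i j)}.
Proof.
split=> [cf i j|cf]; first exact: (@cvg_mx_coord _ (nbhs x) _ _ _ f _ i j cf).
exact: (@cvg_mx _ (nbhs x) _ _ _ f _ cf).
Qed.

Context {V : normedModType R}.

Lemma differentiable_entry m n (f : V -> 'M[R]_(m, n)) x i j :
  differentiable f x -> differentiable (fun y => f y i j) x.
Proof.
move=> df; apply: (differentiable_comp (g := fun A : 'M[R]_(m, n) => A i j)) => //.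
exact: differentiable_coord.
Qed.

Lemma differentiable_mxP m n (f : V -> 'M[R]_(m, n)) x :
  (forall i j, differentiable (fun y => f y i j) x) -> differentiable f x.
Proof.
move=> df.
have -> : f = \sum_(i < m) \sum_(j < n) (fun y => f y i j *: delta_mx i j).
  apply/funext => y; rewrite fct_sumE {1}(matrix_sum_delta (f y)).
  by apply: eq_bigr => i _; rewrite fct_sumE.
apply: differentiable_sum => i; apply: differentiable_sum => j.
exact: differentiableZl.
Qed.

Lemma derive_entry m n (f : V -> 'M[R]_(m, n)) x v i j :
  differentiable f x -> ('D_v f x) i j = 'D_v (fun y => f y i j) x.
Proof. by move=> df; rewrite derive_mx ?mxE//; exact: diff_derivable. Qed.

Lemma differentiable_mulmx m n p (A : V -> 'M[R]_(m, n)) (B : V -> 'M[R]_(n, p)) x :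
  differentiable A x -> differentiable B x -> differentiable (fun y => A y *m B y) x.
Proof.
move=> dA dB; apply: differentiable_mxP => i j.
have -> : (fun y => (A y *m B y) i j) = \sum_k (fun y => A y i k * B y k j).
  by apply/funext => y; rewrite mxE fct_sumE.
apply: differentiable_sum => k.
by apply: differentiableM; exact: differentiable_entry.
Qed.

Lemma derive_mulmx m n p (A : V -> 'M[R]_(m, n)) (B : V -> 'M[R]_(n, p)) x v :
  differentiable A x -> differentiable B x ->
  'D_v (fun y => A y *m B y) x = 'D_v A x *m B x + A x *m 'D_v B x.
Proof.
move=> dA dB; apply/matrixP => i j.
rewrite derive_entry; last exact: differentiable_mulmx.
have -> : (fun y => (A y *m B y) i j) = \sum_k (fun y => A y i k * B y k j).
  by apply/funext => y; rewrite mxE fct_sumE.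
rewrite derive_sum; last first.
  move=> k; apply: diff_derivable.
  by apply: differentiableM; exact: differentiable_entry.
rewrite !mxE -big_split; apply: eq_bigr => k _ /=.
rewrite (@deriveM _ _ (fun y => A y i k) (fun y => B y k j)); first last.
- exact/diff_derivable/differentiable_entry.
- exact/diff_derivable/differentiable_entry.
by rewrite !derive_entry// /GRing.scale/= addrC; congr (_ + _); rewrite mulrC.
Qed.

End MatrixCalculus.

(** * Smooth maps into row vectors and their Jacobians *)

Section SmoothOn.
Context {R : realType} {d : nat}.
Local Notation V := 'rV[R]_d.

Lemma CkP k e (U : set V) (f : V -> 'rV[R]_e) : open U ->
  Ck k U f <-> (forall j, Cks k U (fun x => f x 0 j)).
Proof.
move=> Uo; elim: k f => [|k IH] f /=.
  split=> [cf j x Ux|cf x Ux].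
    by have /continuous_mxP/(_ 0 j) := cf x Ux.
  by apply/continuous_mxP => i j; rewrite (ord1 i); exact: cf.
split=> [[df Df] j|df].
  split=> [x Ux|v]; first exact/differentiable_entry/df.
  have /IH/(_ j) := Df v; apply: Cks_eq => // x Ux.
  by rewrite derive_entry//; exact: df.
have dif x : U x -> differentiable f x.
  move=> Ux; apply: differentiable_mxP => i j; rewrite (ord1 i).
  by have [+ _] := df j; apply.
split=> // v; apply/IH => j; have [_ /(_ v)] := df j.
by apply: Cks_eq => // x Ux; rewrite derive_entry//; exact: dif.
Qed.

Lemma smooth_onP e (U : set V) (f : V -> 'rV[R]_e) : open U ->
  smooth_on U f <-> forall k, smmx k U f.
Proof.
move=> Uo; split=> [sf k i j|sf k].
  by rewrite (ord1 i); move: j; apply/CkP.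
by apply/CkP => // j; exact: sf.
Qed.

Lemma smmx_differentiable k m n (U : set V) (f : V -> 'M[R]_(m, n)) x :
  smmx k.+1 U f -> U x -> differentiable f x.
Proof.
move=> sf Ux; apply: differentiable_mxP => i j.
exact: Cks_differentiable (sf i j) Ux.
Qed.

Lemma smmx_derive k m n (U : set V) (f : V -> 'M[R]_(m, n)) v : open U ->
  smmx k.+1 U f -> smmx k U (fun x => 'D_v f x).
Proof.
move=> Uo sf i j; apply: (Cks_eq Uo _ (Cks_derive v (sf i j))) => x Ux.
by rewrite derive_entry//; exact: smmx_differentiable sf Ux.
Qed.

Lemma row_jacobian e (f : V -> 'rV[R]_e) x i :
  differentiable f x -> row i ('J f x) = 'D_('e_i) f x.
Proof. by move=> df; rewrite deriveEjacobian// rowE. Qed.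

Lemma smmx_jacobian k e (U : set V) (f : V -> 'rV[R]_e) : open U ->
  smmx k.+1 U f -> smmx k U (fun x => 'J f x).
Proof.
move=> Uo sf i j.
apply: (Cks_eq Uo _ (smmx_derive ('e_i) Uo sf 0 j)) => x Ux.
by rewrite -row_jacobian ?mxE//; exact: smmx_differentiable sf Ux.
Qed.

End SmoothOn.

(** * Symmetry of second derivatives *)

Section Schwarz.
Context {R : realType} {V : normedModType R}.
Implicit Types (f : V -> R) (u v x p : V).

Lemma is_derive_line f u p (s : R) : differentiable f (s *: u + p) ->
  is_derive s (1 : R) (fun r => f (r *: u + p)) ('D_u f (s *: u + p)).
Proof.
move=> df; have E : (fun h : R => h^-1 *: (((fun r => f (r *: u + p)) \o shift s) (h *: (1 : R))
    - f (s *: u + p))) =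
  (fun h => h^-1 *: ((f \o shift (s *: u + p)) (h *: u) - f (s *: u + p))).
  apply/funext => h /=; congr (_ *: (f _ - _)).
  by rewrite scalerDl [(h *: 1 : R)]mulr1 addrA.
apply: DeriveDef; rewrite /derivable /derive E //.
exact: diff_derivable.
Qed.

(** Mean value theorem twice: in the direction u for the difference of f along two parallel
    segments, then in the direction v for 'D_u f. *)
Lemma second_difference (U : set V) f u v x (h : R) : 0 < h ->
  (forall s t, 0 <= s <= h -> 0 <= t <= h -> U (s *: u + (t *: v + x))) ->
  (forall y, U y -> differentiable f y) ->
  (forall y, U y -> differentiable ('D_u f) y) ->
  exists s t, [/\ 0 <= s <= h, 0 <= t <= h &
    f (h *: u + (h *: v + x)) - f (h *: u + x) - (f (h *: v + x) - f x)
    = h ^+ 2 * 'D_v ('D_u f) (s *: u + (t *: v + x))].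
Proof.
move=> h0 hU df dDf.
have hU0 s : 0 <= s <= h -> U (s *: u + x).
  by move=> hs; have := hU s 0 hs; rewrite scale0r add0r; apply; rewrite lexx ltW.
have hh : 0 <= h <= h by rewrite lexx ltW.
pose F r := f (r *: u + (h *: v + x)) - f (r *: u + x).
have dF s : 0 <= s <= h ->
    is_derive s (1 : R) F ('D_u f (s *: u + (h *: v + x)) - 'D_u f (s *: u + x)).
  move=> hs; apply: is_deriveB; apply: is_derive_line; apply: df; first exact: hU.
  exact: hU0.
have [||s hs Fs] := @MVT_segment R F
    (fun s => 'D_u f (s *: u + (h *: v + x)) - 'D_u f (s *: u + x)) 0 h (ltW h0).
- by move=> s; rewrite in_itv/= => /andP[s0 sh]; apply: dF; rewrite !ltW.
- apply: derivable_within_continuous => s; rewrite in_itv/= => hs.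
  by have [] := dF s hs.
rewrite in_itv/= in hs.
pose G r := 'D_u f (r *: v + (s *: u + x)).
have swap (t : R) : t *: v + (s *: u + x) = s *: u + (t *: v + x) by rewrite addrCA.
have dG t : 0 <= t <= h ->
    is_derive t (1 : R) G ('D_v ('D_u f) (t *: v + (s *: u + x))).
  by move=> ht; apply: is_derive_line; apply: dDf; rewrite swap; exact: hU.
have [||t ht Gt] := @MVT_segment R G
    (fun t => 'D_v ('D_u f) (t *: v + (s *: u + x))) 0 h (ltW h0).
- by move=> t; rewrite in_itv/= => /andP[t0 th]; apply: dG; rewrite !ltW.
- apply: derivable_within_continuous => t; rewrite in_itv/= => ht.
  by have [] := dG t ht.
rewrite in_itv/= in ht.
exists s, t; split => //.
move: Fs Gt; rewrite /F /G !swap !scale0r !add0r subr0 => -> -> /=.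
by rewrite expr2 mulrC mulrCA mulrC.
Qed.

(** The second difference of f over a small parallelogram is symmetric in u and v, so the two mixed
    derivatives agree at two points of it; continuity at x brings both values back to x. *)
Lemma derive_comm (U : set V) f u v x : open U -> U x ->
  (forall y, U y -> differentiable f y) ->
  (forall y, U y -> differentiable ('D_u f) y) ->
  (forall y, U y -> differentiable ('D_v f) y) ->
  {for x, continuous ('D_v ('D_u f))} -> {for x, continuous ('D_u ('D_v f))} ->
  'D_v ('D_u f) x = 'D_u ('D_v f) x.
Proof.
move=> Uo Ux df dDu dDv cvu cuv.
apply/eqP; rewrite -subr_eq0; apply/eqP/normr0_eq0/eqP; rewrite eq_le normr_ge0 andbT.
apply/ler_addgt0Pl => e e0; rewrite addr0.
have e20 : 0 < e / 2 by rewrite divr_gt0.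
pose P y := [/\ U y, `|'D_v ('D_u f) x - 'D_v ('D_u f) y| < e / 2 &
  `|'D_u ('D_v f) x - 'D_u ('D_v f) y| < e / 2].
have nP : \forall y \near x, P y.
  have /cvgrPdist_lt/(_ _ e20) n1 := cvu.
  have /cvgrPdist_lt/(_ _ e20) n2 := cuv.
  have n3 : nbhs x U by exact: open_nbhs_nbhs.
  have imp y : `|'D_v ('D_u f) x - 'D_v ('D_u f) y| < e / 2 ->
    `|'D_u ('D_v f) x - 'D_u ('D_v f) y| < e / 2 -> U y -> P y by move=> ? ? ?; split.
  exact: (@filterS3 _ (nbhs x) _ _ _ _ _ imp n1 n2 n3).
have [r r0 rP] : exists2 r : R, 0 < r & forall y, `|x - y| < r -> P y.
  by move/nbhs_ballP: nP => [r r0 rP]; exists r => // y yr; apply: rP; rewrite -ball_normE.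
(* The parallelogram with sides h u and h v must fit in the ball of radius r; with this N its points
   are at distance at most h N = r / 2 from x, and the summand 1 keeps N positive when u = v = 0. *)
pose N := `|u| + `|v| + 1.
have N0 : 0 < N by rewrite /N ltr_wpDl// addr_ge0.
pose h := r / N / 2.
have h0 : 0 < h by rewrite !divr_gt0.
have hP s t : 0 <= s <= h -> 0 <= t <= h -> P (s *: u + (t *: v + x)).
  move=> /andP[s0 sh] /andP[t0 th]; apply: rP.
  rewrite addrA opprD addrCA subrr addr0 normrN.
  apply: (@le_lt_trans _ _ (h * N)).
    rewrite (le_trans (ler_normD _ _))// !normrZ !ger0_norm// /N mulrDr mulr1.
    rewrite mulrDr -[leLHS]addr0; apply: lerD; last exact: ltW.
    by apply: lerD; apply: ler_wpM2r.
  by rewrite /h mulrAC divfK ?gt_eqF// ltr_pdivrMr// ltr_pMr// ltr1n.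
have [s [t [hs ht E1]]] := second_difference h0
  (fun s t hs ht => let: And3 a _ _ := hP s t hs ht in a) df dDu.
have hP' s' t' : 0 <= s' <= h -> 0 <= t' <= h -> P (s' *: v + (t' *: u + x)).
  by move=> hs' ht'; rewrite addrCA; exact: hP.
have [s' [t' [hs' ht' E2]]] := second_difference h0
  (fun s t hs ht => let: And3 a _ _ := hP' s t hs ht in a) df dDv.
have L12 : f (h *: u + (h *: v + x)) - f (h *: u + x) - (f (h *: v + x) - f x) =
    f (h *: v + (h *: u + x)) - f (h *: v + x) - (f (h *: u + x) - f x).
  rewrite (addrCA (h *: v)); move: (f _) (f _) (f _) (f x) => a b c k.
  by rewrite !opprB addrACA [RHS]addrACA; congr (_ + _); rewrite addrC.
have cancel (c X Y L L' : R) : c != 0 -> L = L' -> L = c * X -> L' = c * Y -> X = Y.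
  by move=> c0 -> -> /(mulfI c0).
have E := cancel _ _ _ _ _ (expf_neq0 2 (lt0r_neq0 h0)) L12 E1 E2.
have close (a b c c' : R) : c = c' -> `|a - c| < e / 2 -> `|b - c'| < e / 2 -> `|a - b| <= e.
  move=> <- ac; rewrite distrC => bc; apply: (le_trans (ler_distD c _ _)).
  by apply: ltW; rewrite [ltRHS](splitr e); exact: ltrD.
have [_ a1 _] := hP _ _ hs ht; have [_ _ a2] := hP' _ _ hs' ht'.
exact: close E a1 a2.
Qed.

End Schwarz.

Lemma Cks_derive_comm (R : realType) d (U : set 'rV[R]_d) (f : 'rV[R]_d -> R) u v x :
  open U -> Cks 2 U f -> U x -> 'D_v ('D_u f) x = 'D_u ('D_v f) x.
Proof.
move=> Uo sf Ux; apply: (derive_comm Uo Ux).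
- by move=> y Uy; exact: Cks_differentiable sf Uy.
- by move=> y Uy; exact: Cks_differentiable (Cks_derive u sf) Uy.
- by move=> y Uy; exact: Cks_differentiable (Cks_derive v sf) Uy.
- exact: (Cks_derive v (Cks_derive u sf) x Ux).
- exact: (Cks_derive u (Cks_derive v sf) x Ux).
Qed.

Lemma smmx_derive_comm (R : realType) d m n (U : set 'rV[R]_d)
    (f : 'rV[R]_d -> 'M[R]_(m, n)) u v x :
  open U -> smmx 2 U f -> U x -> 'D_v ('D_u f) x = 'D_u ('D_v f) x.
Proof.
move=> Uo sf Ux; apply/matrixP => i j.
have E w w' : ('D_w ('D_w' f) x) i j = 'D_w ('D_w' (fun y => f y i j)) x.
  rewrite derive_entry; last exact: smmx_differentiable (smmx_derive w' Uo sf) Ux.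
  apply: near_eq_derive; apply: (near_open Uo Ux) => y Uy /=.
  by rewrite derive_entry//; exact: smmx_differentiable sf Uy.
transitivity ('D_v ('D_u (fun y => f y i j)) x); first exact: E.
by rewrite (Cks_derive_comm _ _ Uo (sf i j) Ux); exact/esym/E.
Qed.

(** * Half factors of real polynomials *)

Lemma coef_comp_polyNX (R : comNzRingType) (p : {poly R}) i :
  (p \Po (- 'X))`_i = (-1) ^+ i * p`_i.
Proof.
elim/poly_ind: p i => [|p c IH] i; first by rewrite comp_poly0 coef0 mulr0.
rewrite comp_poly_MXaddC mulrN !coefD coefN !coefMX !coefC.
case: i => [|i] /=; first by rewrite oppr0 !add0r mul1r.
by rewrite !addr0 IH exprS mulN1r mulNr.
Qed.

Section HalfFactor.
Context {R : rcfType}.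
Local Notation toC := (map_poly (real_complex R)).
Local Notation conjp := (map_poly (@conjc R)).
Local Notation Re := complex.Re.
Local Notation Im := complex.Im.
Implicit Types (a b chi : {poly R}) (p q : {poly R[i]}) (z : R[i]).

Definition cpoly a b : {poly R[i]} := toC a + ('i%C)%:P * toC b.

Lemma coef_cpoly a b i : (cpoly a b)`_i = Complex a`_i b`_i.
Proof. by rewrite coefD coefCM !coef_map/=; simpc. Qed.

Lemma conj_cpoly a b : conjp (cpoly a b) = cpoly a (- b).
Proof. by apply/polyP => i; rewrite coef_map !coef_cpoly coefN. Qed.

Lemma root_cpolyN a b z : root (cpoly a (- b)) z = root (cpoly a b) z^*%C.
Proof. by rewrite -conj_cpoly complex_root_conj. Qed.

Lemma cpoly_mul_conj a b : cpoly a b * cpoly a (- b) = toC (a ^+ 2 + b ^+ 2).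
Proof.
have i2 : (('i%C)%:P : {poly R[i]}) ^+ 2 = -1 by rewrite -rmorphXn/= sqr_i rmorphN1.
rewrite /cpoly rmorphD/= !rmorphXn/= rmorphN/= mulrN mulrC -subr_sqr exprMn i2.
by rewrite mulN1r opprK.
Qed.

Lemma cpoly_ReIm p : p = cpoly (map_poly (@Re R) p) (map_poly (@Im R) p).
Proof.
apply/polyP => i; rewrite coef_cpoly !coef_map_id0//.
by case: (p`_i).
Qed.

Lemma cpoly_inj a b a' b' : cpoly a b = cpoly a' b' -> a = a' /\ b = b'.
Proof.
by move=> /polyP E; split; apply/polyP => i; have := E i; rewrite !coef_cpoly => -[].
Qed.

(** The pair stands for p = a + i b, monic of degree n (hence the lower degree of b) with all roots
    in the open upper half plane; the third condition is p * conj p = chi. Real pairs are kept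
    because a and b are later evaluated at real matrices. *)
Definition half_factor n chi (ab : {poly R} * {poly R}) : Prop :=
  [/\ ab.1 \is monic /\ size ab.1 = n.+1, (size ab.2 <= n)%N,
      ab.1 ^+ 2 + ab.2 ^+ 2 = chi &
      forall z, root (cpoly ab.1 ab.2) z -> 0 < Im z].

Lemma size_cpoly n a b : a \is monic -> size a = n.+1 -> (size b <= n)%N ->
  size (cpoly a b) = n.+1 /\ cpoly a b \is monic.
Proof.
move=> am sa sb.
have bn : b`_n = 0 by apply: nth_default.
have an : a`_n = 1 by move/monicP: am; rewrite lead_coefE sa.
have E : size (cpoly a b) = n.+1.
  apply/eqP; rewrite eqn_leq; apply/andP; split.
    apply/leq_sizeP => j nj; rewrite coef_cpoly !nth_default ?sa//.
    exact: leq_trans sb (ltnW nj).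
  rewrite ltnNge; apply/negP => /leq_sizeP/(_ n (leqnn n)).
  by rewrite coef_cpoly an bn => -[] /eqP; rewrite oner_eq0.
by split=> //; apply/monicP; rewrite lead_coefE E coef_cpoly an bn.
Qed.

Lemma coprimep_half p q :
  (forall z, root p z -> 0 < Im z) -> (forall z, root q z -> Im z < 0) ->
  coprimep p q.
Proof.
move=> hp hq; apply: Pdiv.ClosedField.root_coprimep => z /hp z0; apply/negP => /hq.
by rewrite ltNge ltW.
Qed.

(** The roots of chi are sorted by the sign of their imaginary part into p and q; it remains to see
    that q is the conjugate of p, which also gives 2 deg p = deg chi. *)
Lemma half_factor_exists n chi : chi \is monic -> size chi = n.*2.+1 ->
  (forall x, ~~ root chi x) -> exists ab, half_factor n chi ab.
Proof.
move=> chim chis nroot.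
have [rs] := closed_field_poly_normal (toC chi).
rewrite (monicP _) ?map_monic// scale1r => chiE.
have rsE z : root (toC chi) z = (z \in rs) by rewrite chiE root_prod_XsubC.
have rs0 z : z \in rs -> Im z != 0.
  rewrite -rsE; apply: contraL => /eqP z0; have -> : z = (Re z)%:C%C.
    by case: z z0 => u v /= ->.
  by rewrite fmorph_root; exact: nroot.
pose prd (P : pred R[i]) := \prod_(z <- rs | P z) ('X - z%:P).
pose p := prd (fun z => 0 < Im z); pose q := prd (fun z => Im z < 0).
have pm P : prd P \is monic by rewrite monic_prod// => z _; exact: monicXsubC.
have pr P z : root (prd P) z = P z && (z \in rs).
  by rewrite /prd -big_filter root_prod_XsubC mem_filter.
have chipq : toC chi = p * q.
  rewrite chiE (bigID (fun z => 0 < Im z))/=; congr (_ * _).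
  rewrite /q /prd big_seq_cond [RHS]big_seq_cond; apply: eq_bigl => z.
  case: (boolP (z \in rs)) => //= /rs0 z0; rewrite -leNgt le_eqVlt.
  by rewrite (negbTE z0).
have conjchi : conjp (toC chi) = toC chi.
  by apply/polyP => i; rewrite !coef_map/=; congr Complex; rewrite oppr0.
have conjpq : conjp p * conjp q = p * q by rewrite -rmorphM/= -chipq.
have conjm P : conjp (prd P) \is monic by rewrite map_monic.
have rc P z : root (conjp (prd P)) z = root (prd P) z^*%C by rewrite complex_root_conj.
have ImJ z : Im (z^*)%C = - Im z by case: z.
have qm : q \is monic by exact: pm.
have cpm : conjp p \is monic by exact: conjm.
(* From conj p * conj q = p * q: q has its roots below the axis and conj q above, so q divides conj
   p by coprimality, and likewise conj p divides q. No count of root multiplicities is involved. *)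
have qE : q = conjp p.
  apply/eqP; rewrite -eqp_monic// /eqp; apply/andP; split.
    rewrite -(@Gauss_dvdpl _ _ (conjp q)) ?conjpq ?dvdp_mull// coprimep_sym.
    by apply: coprimep_half => z; rewrite ?rc pr => /andP[]; rewrite ?ImJ ?oppr_lt0.
  rewrite -(@Gauss_dvdpr _ _ p) -?conjpq ?dvdp_mulr// coprimep_sym.
  by apply: coprimep_half => z; rewrite ?rc pr => /andP[]; rewrite ?ImJ ?oppr_gt0.
pose a := map_poly (@Re R) p; pose b := map_poly (@Im R) p.
have pE : p = cpoly a b by exact: cpoly_ReIm.
have sp : size p = n.+1.
  have : size (toC chi) = (size p + size q).-1.
    by rewrite chipq (size_Mmonic (monic_neq0 (pm _)) qm).
  rewrite qE size_map_poly size_map_poly chis addnn.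
  case: (size p) => [|m]; first by [].
  by rewrite doubleS/= => -[/double_inj<-].
have pn : p`_n = 1 by have /monicP := pm (fun z => 0 < Im z); rewrite lead_coefE -/p sp.
have coefa i : a`_i = Re p`_i by rewrite coef_map_id0.
have coefb i : b`_i = Im p`_i by rewrite coef_map_id0.
have sa : size a = n.+1.
  apply/eqP; rewrite eqn_leq; apply/andP; split.
    by apply/leq_sizeP => j nj; rewrite coefa nth_default ?sp.
  rewrite ltnNge; apply/negP => /leq_sizeP/(_ n (leqnn n)).
  by rewrite coefa pn => /eqP; rewrite oner_eq0.
exists (a, b); split => /=.
- by split=> //; apply/monicP; rewrite lead_coefE sa coefa pn.
- apply/leq_sizeP => j; rewrite leq_eqVlt => /orP[/eqP<-|nj]; rewrite coefb ?pn//.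
  by rewrite nth_default ?sp.
- apply: (map_poly_inj (real_complex R)).
  by rewrite -[LHS]cpoly_mul_conj -conj_cpoly -pE -qE.
- by move=> z; rewrite -pE pr => /andP[].
Qed.

(** The first p is coprime to the conjugate of the second, their roots lying on opposite sides of
    the axis; so it divides the second p, which is monic of the same degree. *)
Lemma half_factor_uniq n chi ab ab' :
  half_factor n chi ab -> half_factor n chi ab' -> ab = ab'.
Proof.
case: ab ab' => [a b] [a' b'] [/= [am sa] sb ab hr] [/= [am' sa'] sb' ab' hr'].
have [sp pm] := size_cpoly am sa sb; have [sp' pm'] := size_cpoly am' sa' sb'.
have ImJ z : Im (z^*)%C = - Im z by case: z.
have E : cpoly a b * cpoly a (- b) = cpoly a' b' * cpoly a' (- b').
  by rewrite !cpoly_mul_conj ab ab'.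
have dvd : cpoly a b %| cpoly a' b'.
  rewrite -(@Gauss_dvdpl _ _ (cpoly a' (- b'))) -?E ?dvdp_mulr//.
  apply: coprimep_half => // z; rewrite root_cpolyN => /hr'.
  by rewrite ImJ oppr_gt0.
have := dvdp_size_eqp dvd; rewrite sp sp' eqxx => /esym.
by rewrite (eqp_monic pm pm') => /eqP /cpoly_inj[-> ->].
Qed.

(** A common root z of a and b is a root of both p and conj p, so z and its conjugate would both lie
    above the axis. *)
Lemma half_factor_coprime n chi ab : half_factor n chi ab -> coprimep ab.1 ab.2.
Proof.
case: ab => a b [/= [am sa] sb ab hr].
rewrite -(coprimep_map (real_complex R)); apply: Pdiv.ClosedField.root_coprimep => z az.
apply/negP => bz.
have rz : root (cpoly a b) z.
  by rewrite rootE hornerD hornerM (rootP az) (rootP bz) mulr0 addr0.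
have rzN : root (cpoly a (- b)) z.
  by rewrite rootE hornerD hornerM rmorphN/= hornerN (rootP az) (rootP bz) oppr0 mulr0 addr0.
have := hr _ rz; rewrite root_cpolyN in rzN; have := hr _ rzN.
by case: z {az bz rz rzN} => u v /=; rewrite oppr_gt0 => /lt_trans h /h; rewrite ltxx.
Qed.

(** The reflection z -> - conj z preserves the upper half plane, so (-1)^n (conj p)(- X) is another
    half factor of the even polynomial chi; uniqueness identifies it with p. *)
Lemma half_factor_even n chi ab : half_factor n chi ab ->
  chi \Po (- 'X) = chi ->
  ab.1 \Po (- 'X) = (-1) ^+ n *: ab.1 /\ ab.2 \Po (- 'X) = - ((-1) ^+ n *: ab.2).
Proof.
case: ab => a b hab evn; have [/= [am sa] sb ab hr] := hab.
pose s : R := (-1) ^+ n.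
have an : a`_n = 1 by move/monicP: am; rewrite lead_coefE sa.
have ss : s * s = 1 by rewrite -expr2 sqrr_sign.
have coefs (f : {poly R}) i : (s *: (f \Po (- 'X)))`_i = s * ((-1) ^+ i * f`_i).
  by rewrite coefZ coef_comp_polyNX.
have sz (f : {poly R}) : size (s *: (f \Po (- 'X))) = size f.
  rewrite size_scale ?signr_eq0// size_comp_poly2// size_polyN size_polyX//.
have E : cpoly (s *: (a \Po (- 'X))) (- (s *: (b \Po (- 'X)))) =
    (-1) ^+ n *: (cpoly a (- b) \Po (- 'X)).
  apply/polyP => i; rewrite coefZ coef_comp_polyNX !coef_cpoly !coefN !coefs.
  have sgC (k : nat) (c : R[i]) : (-1) ^+ k * c = ((-1) ^+ k : R)%:C%C * c.
    by rewrite rmorphXn/= rmorphN1.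
  by rewrite !sgC; simpc.
suff hab' : half_factor n chi (s *: (a \Po (- 'X)), - (s *: (b \Po (- 'X)))).
  have [ea eb] := half_factor_uniq hab hab'.
  rewrite {2}ea {2}eb/= scalerN !scalerA ss !scale1r opprK; split=> //.
split=> /=.
- split; last by rewrite sz.
  by apply/monicP; rewrite lead_coefE sz sa/= coefs an mulr1 ss.
- by rewrite size_polyN sz.
- rewrite sqrrN !exprZn -/s -!scalerDr.
  have -> : s ^+ 2 = 1 by rewrite expr2.
  by rewrite scale1r -!rmorphXn/= -comp_polyD ab.
- move=> z; rewrite E rootZ ?signr_eq0// => rz.
  have := hr (- z)^*%C; rewrite -root_cpolyN.
  have -> : root (cpoly a (- b)) (- z).
    by move: rz; rewrite !rootE horner_comp hornerN hornerX.
  by move=> /(_ isT); case: z {rz} => u v /=; rewrite opprK.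
Qed.

Definition sqmod z : R := Re z ^+ 2 + Im z ^+ 2.

Lemma sqmodM z w : sqmod (z * w) = sqmod z * sqmod w.
Proof. by case: z w => [a b] [c e]; rewrite /sqmod /=; ring. Qed.

(* No root of a half factor lies below the axis, hence none is at distance less
   than [|Im z|] of a point [z] of the lower half plane. Unlike the condition on
   the roots, this estimate survives passage to the limit. *)
Lemma half_factor_sqmod_ge n chi ab z : half_factor n chi ab -> Im z < 0 ->
  (Im z ^+ 2) ^+ n <= sqmod (cpoly ab.1 ab.2).[z].
Proof.
case: ab => a b [/= [am sa] sb ab hr] z0.
have [sp pm] := size_cpoly am sa sb.
have [rs pE] := closed_field_poly_normal (cpoly a b).
rewrite (monicP pm) scale1r in pE.
have hrs r : r \in rs -> 0 < Im r.
  by move=> rrs; apply: hr; rewrite pE root_prod_XsubC.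
have <- : size rs = n by move: sp; rewrite pE size_prod_XsubC => -[].
rewrite pE {pE}; elim: rs hrs => [|r rs IH] hrs.
  by rewrite big_nil hornerC /sqmod /= expr0n addr0 expr1n.
rewrite big_cons hornerM sqmodM /= [X in X <= _]exprS; apply: ler_pM.
- exact: sqr_ge0.
- by rewrite exprn_ge0 ?sqr_ge0.
- rewrite hornerXsubC; have := hrs r (mem_head _ _).
  case: r z {hrs IH pm sp sa hr} z0 => [u v] [x y] /= y0 v0.
  rewrite /sqmod /=; have := sqr_ge0 (x - u); have : y * v <= 0 by nra.
  by nra.
- by apply: IH => s srs; apply: hrs; rewrite inE srs orbT.
Qed.

(** For fixed z both parts of p(z) are linear in the coefficients of a and b, which makes them
    continuous in these coefficients. *)
Lemma ReIm_horner_cpoly N a b z : (size a <= N)%N -> (size b <= N)%N ->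
  (cpoly a b).[z] = Complex (\sum_(k < N) (a`_k * Re (z ^+ k) - b`_k * Im (z ^+ k)))
                            (\sum_(k < N) (a`_k * Im (z ^+ k) + b`_k * Re (z ^+ k))).
Proof.
move=> sa sb; rewrite (@horner_coef_wide _ N); last first.
  apply/leq_sizeP => j Nj; rewrite coef_cpoly !nth_default//; exact: leq_trans Nj.
transitivity (\sum_(k < N) Complex (a`_k * Re (z ^+ k) - b`_k * Im (z ^+ k))
                                   (a`_k * Im (z ^+ k) + b`_k * Re (z ^+ k))).
  by apply: eq_bigr => k _; rewrite coef_cpoly; case: (z ^+ k).
have sumC (I : Type) (s : seq I) (F G : I -> R) :
    \sum_(k <- s) Complex (F k) (G k) = Complex (\sum_(k <- s) F k) (\sum_(k <- s) G k).
  by elim: s => [|k s IH]; rewrite ?big_nil// !big_cons IH.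
exact: sumC.
Qed.

End HalfFactor.

(** * The complex structure attached to a matrix without real eigenvalues *)

Section CharPoly.
Context {F : fieldType} {m : nat}.
Implicit Types A B P : 'M[F]_m.

Lemma char_poly_conj A B P : P \in unitmx -> P *m A = B *m P ->
  char_poly A = char_poly B.
Proof.
move=> Pu PA.
have E : map_mx polyC P *m char_poly_mx A = char_poly_mx B *m map_mx polyC P.
  by rewrite /char_poly_mx mulmxBr mulmxBl -!map_mxM PA scalar_mxC.
have P0 : \det (map_mx polyC P) != 0.
  by rewrite det_map_mx polyC_eq0 -unitfE -unitmxE.
by apply: (mulfI P0); rewrite /char_poly -!det_mulmx E !det_mulmx mulrC.
Qed.

Lemma char_poly_tr A : char_poly A^T = char_poly A.
Proof.
rewrite /char_poly -[RHS]det_tr; congr (\det _).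
by rewrite /char_poly_mx [RHS]linearB /= tr_scalar_mx map_trmx.
Qed.

Lemma char_polyN A : char_poly (- A) = (-1) ^+ m *: (char_poly A \Po (- 'X)).
Proof.
have E : map_mx (comp_poly (- 'X)) (char_poly_mx A) = (-1) *: char_poly_mx (- A).
  apply/matrixP => i j; rewrite !mxE comp_polyB comp_polyC polyCN opprK mulN1r opprD.
  by case: (i == j); rewrite ?mulr1n ?comp_polyX// mulr0n comp_poly0 oppr0.
rewrite -[_ \Po _]/(comp_poly _ _) /char_poly -det_map_mx E detZ.
by rewrite -mul_polyC rmorphXn/= rmorphN1 mulrA -exprMn mulrNN mulr1 expr1n mul1r.
Qed.

End CharPoly.

Section HornerMx.
Context {F : fieldType} {m : nat}.
Implicit Types (A B P : 'M[F]_m.+1) (p : {poly F}).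

Lemma horner_mx_intertwine A B P p : P *m A = B *m P ->
  P *m horner_mx A p = horner_mx B p *m P.
Proof.
move=> PA; elim/poly_ind: p => [|p c IH]; first by rewrite !rmorph0 mulmx0 mul0mx.
rewrite !rmorphD !rmorphM /= !horner_mx_X !horner_mx_C mulmxDr mulmxDl scalar_mxC.
by rewrite mulmxA IH -mulmxA PA mulmxA.
Qed.

Lemma horner_mx_tr A p : (horner_mx A p)^T = horner_mx A^T p.
Proof.
elim/poly_ind: p => [|p c IH]; first by rewrite !rmorph0 trmx0.
rewrite !rmorphD !rmorphM /= !horner_mx_X !horner_mx_C linearD /= tr_scalar_mx.
congr (_ + _); rewrite trmx_mul IH; exact: (horner_mx_intertwine p (erefl (A^T *m A^T))).
Qed.

Lemma horner_mxN A p : horner_mx (- A) p = horner_mx A (p \Po (- 'X)).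
Proof.
elim/poly_ind: p => [|p c IH]; first by rewrite comp_poly0 !rmorph0.
rewrite comp_poly_MXaddC !rmorphD !rmorphM /= IH !horner_mx_X !horner_mx_C.
by rewrite rmorphN/= horner_mx_X.
Qed.

End HornerMx.

Section ImaginaryPart.
Context {R : rcfType} {m n : nat}.
Implicit Types (A B P : 'M[R]_m.+1) (ab : {poly R} * {poly R}).

(* Since [ab.1 + 'i ab.2] vanishes on the eigenvalues in the upper half plane and
   [ab.1 - 'i ab.2] on the others, [- ab.1 / ab.2] takes the value ['i] on the
   former and [- 'i] on the latter. *)
Definition imag_mx ab A : 'M[R]_m.+1 := - (horner_mx A ab.1 *m invmx (horner_mx A ab.2)).

Section Fixed.
Variables (A : 'M[R]_m.+1) (ab : {poly R} * {poly R}).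
Hypothesis hab : half_factor n (char_poly A) ab.

Lemma half_factor_mx_sqr : horner_mx A ab.1 *m horner_mx A ab.1 =
  - (horner_mx A ab.2 *m horner_mx A ab.2).
Proof.
apply/eqP; rewrite -addr_eq0 -[_ *m _ + _]/(_ * _ + _ * _) -!rmorphM -rmorphD/= -!expr2.
by case: hab => _ _ -> _; rewrite Cayley_Hamilton.
Qed.

(** b is coprime to a, hence to chi = a^2 + b^2. A Bezout relation u chi + v b = 1 evaluated at A
    becomes v(A) b(A) = 1. *)
Lemma half_factor_mx_unit : horner_mx A ab.2 \in unitmx.
Proof.
have cop := half_factor_coprime hab.
have /Bezout_eq1_coprimepP[[u v] /= /(congr1 (horner_mx A))] : coprimep (char_poly A) ab.2.
  case: hab => _ _ <- _; rewrite coprimep_sym expr2 [ab.2 ^+ 2]expr2 addrC.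
  by rewrite coprimep_addl_mul coprimepMr coprimep_sym cop.
rewrite rmorphD !rmorphM /= Cayley_Hamilton mulr0 add0r rmorph1 => E.
by have [] := mulmx1_unit E.
Qed.

Let a := horner_mx A ab.1.
Let b := horner_mx A ab.2.

Let abC : a *m invmx b = invmx b *m a.
Proof.
have bu := half_factor_mx_unit.
apply: (canRL (mulKmx bu)); rewrite mulmxA -/b.
have -> : b *m a = a *m b by exact: (comm_horner_mx2 A ab.2 ab.1).
by rewrite mulmxK.
Qed.

Lemma imag_mxK : imag_mx ab A *m imag_mx ab A = - 1%:M.
Proof.
have bu := half_factor_mx_unit.
rewrite /imag_mx mulmxN mulNmx opprK -/a -/b {1}abC -mulmxA (mulmxA a a).
rewrite /a half_factor_mx_sqr -/b mulNmx mulmxN mulmxK// mulVmx//.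
Qed.

Lemma imag_mx_comm : imag_mx ab A *m A = A *m imag_mx ab A.
Proof.
have bu := half_factor_mx_unit.
rewrite /imag_mx mulNmx mulmxN; congr (- _); rewrite -/a -/b.
have aA : A *m a = a *m A by exact: (horner_mx_intertwine _ (erefl (A *m A))).
have bA : A *m b = b *m A by exact: (horner_mx_intertwine _ (erefl (A *m A))).
rewrite [RHS]mulmxA aA -!mulmxA; congr (_ *m _).
by apply/esym/(canRL (mulKmx bu)); rewrite mulmxA -bA mulmxK.
Qed.

End Fixed.

(** The source of both frame independence and smoothness of the construction: a change of basis acts
    on K as it acts on A. *)
Lemma imag_mx_conj A B P ab : half_factor n (char_poly A) ab ->
  P \in unitmx -> P *m A = B *m P -> P *m imag_mx ab A = imag_mx ab B *m P.
Proof.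
move=> hab Pu PA.
have hab' : half_factor n (char_poly B) ab by rewrite -(char_poly_conj Pu PA).
have bu := half_factor_mx_unit hab; have bu' := half_factor_mx_unit hab'.
rewrite /imag_mx mulmxN mulNmx mulmxA (horner_mx_intertwine _ PA) -!mulmxA.
congr (- (_ *m _)); apply: (canRL (mulKmx bu')).
by rewrite mulmxA -(horner_mx_intertwine _ PA) mulmxK.
Qed.

(* If [W] is skew and [G] symmetric, then [A = W G^-1] is [G]-skew; its
   characteristic polynomial is even, so that [imag_mx ab A] is [G]-skew too. *)
Lemma imag_mx_form A W G ab : ~~ odd m.+1 -> half_factor n (char_poly A) ab ->
  G \in unitmx -> G^T = G -> W^T = - W -> A *m G = W ->
  imag_mx ab A *m W *m (imag_mx ab A)^T = W.
Proof.
move=> em hab Gu GT WT AG.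
have GA : G *m A^T = - A *m G.
  by rewrite -{1}GT -trmx_mul AG WT mulNmx AG.
have ev : char_poly A \Po (- 'X) = char_poly A.
  rewrite -[RHS]char_poly_tr (char_poly_conj Gu GA) char_polyN.
  by rewrite -signr_odd (negbTE em) expr0 scale1r.
have [ea eb] := half_factor_even hab ev.
have bu := half_factor_mx_unit hab.
have habT : half_factor n (char_poly A^T) ab by rewrite char_poly_tr.
have sk : imag_mx ab (- A) = - imag_mx ab A.
  rewrite /imag_mx !horner_mxN ea eb -scaleNr !linearZ/= invmxZ; last first.
    by rewrite unitmxZ// unitfE oppr_eq0 signr_eq0.
  rewrite -scalemxAl -scalemxAr scalerA invrN invr_sign mulrN -expr2 sqrr_sign.
  by rewrite scaleN1r.
have GK : G *m (imag_mx ab A)^T = - imag_mx ab A *m G.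
  have -> : (imag_mx ab A)^T = imag_mx ab A^T.
    rewrite /imag_mx linearN /= trmx_mul trmx_inv !horner_mx_tr.
    congr (- _); have bu' := half_factor_mx_unit habT.
    apply: (canRL (mulmxK bu')); rewrite -mulmxA.
    have -> : horner_mx A^T ab.1 *m horner_mx A^T ab.2 =
       horner_mx A^T ab.2 *m horner_mx A^T ab.1 by exact: (comm_horner_mx2 A^T ab.1 ab.2).
    by rewrite mulKmx.
  by rewrite (imag_mx_conj habT Gu GA) sk.
(* K W K^T = K A G K^T = - K A K G = - K K A G = A G = W. *)
move: (imag_mxK hab) (imag_mx_comm hab) GK; move: (imag_mx ab A) => K KK KA GK.
rewrite -{1}AG -!mulmxA GK mulNmx !mulmxN !mulmxA -(mulmxA K A) -KA.
by rewrite !mulmxA KK mulNmx mul1mx mulNmx opprK AG.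
Qed.

End ImaginaryPart.

(** * Smooth dependence of the half factor *)

Section DifferentiableProducts.
Context {R : realType} {V : normedModType R}.

Lemma differentiable_lipschitz_at (c : V -> R) x : differentiable c x ->
  exists2 K : R, 0 < K & \forall y \near (0 : V), `|c (y + x) - c x| <= K * `|y|.
Proof.
move=> dc; have /linear_lipschitz[K K0 HK] := diff_continuous dc.
exists (K + 1); first by rewrite addr_gt0.
have /eqaddoP/(_ _ ltr01) := diff_locally dc.
apply: filterS => y; rewrite !fctE /= mul1r => Hy.
have -> : c (y + x) - c x = (c (y + x) - (c x + 'd c x y)) + 'd c x y.
  by rewrite opprD addrA subrK.
rewrite (le_trans (ler_normD _ _))// addrC mulrDl mul1r.
by apply: lerD; [exact: HK|exact: Hy].
Qed.

Lemma derive_subr_cst {W : normedModType R} (h : V -> W) (a : W) x v :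
  differentiable h x -> 'D_v (fun y => h y - a) x = 'D_v h x.
Proof.
move=> dh; have dc : derivable (cst a : V -> W) x v by exact/diff_derivable/differentiable_cst.
rewrite -[LHS]/('D_v (h - cst a) x) (deriveB (diff_derivable dh) dc).
by rewrite derive_cst subr0.
Qed.

(** Up to the differentiable term m(x) (c(y) - c(x)), this is an increment of order O(y - x) times
    an o(1). It allows the factor m to be merely continuous, as the inverse linearisation is at the
    start of the bootstrap. *)
Lemma differentiable_incrM (c m : V -> R) x :
  differentiable c x -> {for x, continuous m} ->
  differentiable (fun y => (c y - c x) * m y) x.
Proof.
move=> dc cm.
have -> : (fun y => (c y - c x) * m y) =
    (fun y => m x *: (c y - c x)) + (fun y => (c y - c x) * (m y - m x)).
  by apply/funext => y; rewrite !fctE /GRing.scale/= [m x * _]mulrC -mulrDr [m x + _]addrC subrK.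
apply: differentiableD.
  by apply: differentiableZ; apply: differentiableB => //; exact: differentiable_cst.
apply: differentiable_small; first by rewrite subrr mul0r.
have [K K0 HK] := differentiable_lipschitz_at dc => e e0.
have cm0 : \forall y \near (0 : V), `|m (y + x) - m x| <= e / K.
  have /cvgrPdist_le/(_ (e / K)) := cm; rewrite divr_gt0// => /(_ isT) H.
  by apply: filterS (near_translate H) => y; rewrite distrC.
have imp y : `|c (y + x) - c x| <= K * `|y| -> `|m (y + x) - m x| <= e / K ->
    `|(c (y + x) - c x) * (m (y + x) - m x)| <= e * `|y|.
  move=> h1 h2; rewrite normrM (le_trans (ler_pM _ _ h1 h2))//.
  by rewrite mulrC mulrA divfK// gt_eqF.
exact: (@filterS2 _ (nbhs (0 : V)) _ _ _ _ imp HK cm0).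
Qed.

End DifferentiableProducts.

(* Bootstrapping for a continuous solution [f] of a quadratic equation
   [Q (f y) = c y]: since [Q w - Q w'] is [(w - w') *m L (w + w')], the map [f] is
   as smooth as [c] wherever the linearisation [L (f y + f y)] is invertible. *)
Section QuadraticBootstrap.
Context {R : realType} {d m : nat}.
Variables (U : set 'rV[R]_d) (f c : 'rV[R]_d -> 'rV[R]_m).
Variable L : 'rV[R]_m -> 'M[R]_m.
Hypothesis Uo : open U.
Hypothesis fc : forall x, U x -> {for x, continuous f}.
Hypothesis cs : forall k, smmx k U c.
(** The dimension e varies because the hypothesis is used both for maps on the given open set and
    for the identity of 'rV_m, where it says that L itself is smooth. *)
Hypothesis Ls : forall e k (U' : set 'rV[R]_e) (g : 'rV[R]_e -> 'rV[R]_m),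
  open U' -> smmx k U' g -> smmx k U' (fun x => L (g x)).
Hypothesis fL : forall x y, U x -> U y -> c y - c x = (f y - f x) *m L (f y + f x).
Hypothesis Lu : forall x, U x -> L (f x + f x) \in unitmx.

Let f0 : smmx 0 U f.
Proof.
by move=> i j x Ux; have /continuous_mxP := fc Ux; apply.
Qed.

(** Where L (f y + f x) is invertible, in particular near x, f y = f x + (c y - c x) L (f y + f
    x)^-1: an increment of the smooth c times a continuous factor. *)
Let f_differentiable x : U x -> differentiable f x.
Proof.
move=> Ux.
have sL : smmx 0 U (fun y => L (f y + f x)).
  by apply: Ls => //; apply: smmxD => //; exact: smmx_cst.
pose U' := U `&` [set y | \det (L (f y + f x)) != 0].
have U'o : open U' by apply: open_neq0 => //; exact: Cks_det.
have U'x : U' x by split=> //=; have := Lu Ux; rewrite unitmxE unitfE.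
have U'u y : U' y -> L (f y + f x) \in unitmx.
  by case=> _ /=; rewrite unitmxE unitfE.
have sI : smmx 0 U' (fun y => invmx (L (f y + f x))).
  by apply: smmx_inv => //; apply: smmx_sub sL => y [].
pose g y := f x + (c y - c x) *m invmx (L (f y + f x)).
have gf y : U' y -> g y = f y.
  by move=> U'y; have [Uy _] := U'y; rewrite /g fL// mulmxK ?U'u// addrC subrK.
apply: (@near_eq_differentiable _ _ _ g).
  exact: near_open U'o U'x gf.
apply: differentiableD; first exact: differentiable_cst.
apply: differentiable_mxP => i j.
have -> : (fun y => ((c y - c x) *m invmx (L (f y + f x))) i j) =
    \sum_l (fun y => (c y i l - c x i l) * invmx (L (f y + f x)) l j).
  by apply/funext => y; rewrite mxE fct_sumE; apply: eq_bigr => l _; rewrite !mxE.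
apply: differentiable_sum => l; apply: differentiable_incrM.
  exact: (Cks_differentiable (cs 1 i l) Ux).
exact: sI.
Qed.

(** Differentiating [fL] at y = x kills the term carrying f x - f x and leaves D c = D f L (2 f x).
    Hence D f = D c L (2 f x)^-1 is C^k as soon as f is. *)
Lemma quadratic_bootstrap k : smmx k U f.
Proof.
elim: k => [|k IH]; first exact: f0.
move=> i j; split=> [x Ux|v]; first by apply: differentiable_entry; exact: f_differentiable.
have sI : smmx k U (fun y => invmx (L (f y + f y))).
  by apply: smmx_inv => //; apply: Ls => //; exact: smmxD.
have sD := smmxM Uo (smmx_derive v Uo (cs k.+1)) sI.
apply: (Cks_eq Uo _ (sD i j)) => x Ux.
rewrite -derive_entry; last exact: f_differentiable.
have fdif : differentiable (fun y => f y - f x) x.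
  by apply: differentiableB => //; exact: f_differentiable.
have Ldif : differentiable (fun y => L (f y + f x)) x.
  apply: (@differentiable_comp _ _ _ _ (fun y => f y + f x) L).
    by apply: differentiableD => //; exact: f_differentiable.
  apply: (smmx_differentiable (k := 0) (U := setT)) => //.
  apply: Ls; first exact: openT.
  move=> {}i {}j; split=> [y _|w]; first exact: differentiable_coord.
  rewrite (_ : (fun y => _) = fun=> w i j); first exact: Cks_cst.
  by apply/funext => y; rewrite -derive_entry ?derive_id.
have -> : 'D_v c x = 'D_v f x *m L (f x + f x).
  have -> : 'D_v c x = 'D_v (fun y => (f y - f x) *m L (f y + f x)) x.
    transitivity ('D_v (fun y => c y - c x) x).
      by rewrite derive_subr_cst//; exact: smmx_differentiable (cs 1) Ux.
    by apply: near_eq_derive; apply: (near_open Uo Ux) => y Uy; exact: fL.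
  rewrite derive_mulmx// subrr mul0mx addr0; congr (_ *m _).
  by rewrite derive_subr_cst//; exact: f_differentiable.
by rewrite mulmxK// Lu.
Qed.
End QuadraticBootstrap.

(** * Continuity through cluster points *)

Section ClusterLimit.
Context {R : realType} {T : topologicalType} {m : nat}.
Variables (f : T -> 'rV[R]_m) (x : T).

Lemma cluster_ge (h : 'rV[R]_m -> R) (c : R) w :
  (forall w, {for w, continuous h}) -> (\forall y \near x, c <= h (f y)) ->
  cluster (f @ nbhs x) w -> c <= h w.
Proof.
move=> ch cf cw.
pose C := [set w | c <= h w].
have cC : closed C.
  apply: (@preimage_closed _ _ h [set r | c <= r]); last exact: closed_ge.
  by move=> v _; exact: ch.
have : closure C w by rewrite clusterE in cw; exact: cw.
by rewrite closure_id in cC; rewrite -cC.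
Qed.

(** Since g y moves with y, the equation is not one closed condition on f y; it is recovered from
    the closed conditions |h - g x| <= e, for every e > 0. *)
Lemma cluster_eq (h : 'rV[R]_m -> R) (g : T -> R) w :
  (forall w, {for w, continuous h}) -> {for x, continuous g} ->
  (\forall y \near x, h (f y) = g y) ->
  cluster (f @ nbhs x) w -> h w = g x.
Proof.
move=> ch cg hg cw; apply/eqP; rewrite -subr_eq0 -normr_le0.
apply/ler_addgt0Pl => e e0; rewrite addr0.
pose k v := - `|h v - g x|.
have ck v : {for v, continuous k}.
  apply: (@continuousN _ _ _ (fun v => `|h v - g x|)).
  apply: (@continuous_comp _ _ _ (fun v => h v - g x) (fun r : R => `|r|)).
    by apply: (@continuousB _ _ _ h (cst (g x))) => //; exact: cst_continuous.
  exact: norm_continuous.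
rewrite -lerN2; apply: (cluster_ge ck _ cw).
have /cvgrPdist_le/(_ _ e0) near_g := cg.
have imp y : `|g x - g y| <= e -> h (f y) = g y -> - e <= k (f y).
  by move=> h1 h2; rewrite /k lerN2 h2 distrC.
exact: (@filterS2 _ (nbhs x) _ _ _ _ imp near_g hg).
Qed.

Lemma continuous_cluster_uniq (M : R) : (\forall y \near x, `|f y| <= M) ->
  (forall w, cluster (f @ nbhs x) w -> w = f x) -> {for x, continuous f}.
Proof.
move=> fM clu.
(* The radius M + 1 makes the compact ball K a neighbourhood of f x, whose norm is at most M. *)
pose K := [set w : 'rV[R]_m | `|w| <= M + 1].
have Kc : compact K.
  apply: bounded_closed_compact.
    by exists (M + 1); split; [exact: num_real|move=> r Mr w /= /le_trans; apply; exact: ltW].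
  apply: (@preimage_closed _ _ (fun w : 'rV[R]_m => `|w|) [set r | r <= M + 1]).
    by move=> v _; exact: norm_continuous.
  exact: closed_le.
apply: (@compact_cluster_set1 _ _ _ K) => //.
- have no : open [set w : 'rV[R]_m | `|w| < M + 1].
    apply: (@open_comp _ _ (fun w : 'rV[R]_m => `|w|) [set r | r < M + 1]).
      by move=> v _; exact: norm_continuous.
    exact: open_lt.
  apply: (@filterS _ (nbhs (f x)) _ [set w | `|w| < M + 1]); first by move=> w /ltW.
  apply: open_nbhs_nbhs; split=> //=.
  by rewrite (le_lt_trans (nbhs_singleton fM))// ltrDl.
- by apply: (@filterS _ (nbhs x) _ _ _ _ fM) => y /le_trans; apply; rewrite lerDl.
- apply/seteqP; split=> w /=; first exact: clu.
  move=> -> A B FA FB; exists (f x); split; last exact: nbhs_singleton FB.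
  exact: (nbhs_singleton FA).
Qed.

End ClusterLimit.

(** * Half factors as vectors of coefficients *)

Section PolyVectors.
Context {R : realType} {n : nat}.
Implicit Types (w : 'rV[R]_(n + n)) (ab : {poly R} * {poly R}).

(** Affine coordinates on the pairs with a monic of degree n and b of degree less than n: 2n free
    coefficients, as many as chi has below its leading one. *)
Definition pair_of_row w : {poly R} * {poly R} :=
  ('X^n + rVpoly (lsubmx w), rVpoly (rsubmx w)).

Definition row_of_pair ab : 'rV[R]_(n + n) :=
  row_mx (poly_rV (ab.1 - 'X^n)) (poly_rV ab.2).

Lemma pair_of_rowK w : row_of_pair (pair_of_row w) = w.
Proof. by rewrite /row_of_pair /= addrC addKr !rVpolyK hsubmxK. Qed.

Lemma size_rVpoly (v : 'rV[R]_n) : (size (rVpoly v) <= n)%N.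
Proof. exact: size_poly. Qed.

Lemma pair_of_row1 w : (pair_of_row w).1 \is monic /\ size (pair_of_row w).1 = n.+1.
Proof.
have sz : (size (rVpoly (lsubmx w)) < size ('X^n : {poly R}))%N.
  by rewrite size_polyXn ltnS size_rVpoly.
split; last by rewrite size_polyDl// size_polyXn.
by rewrite monicE lead_coefDl// lead_coefXn.
Qed.

Lemma size_monic_subXn (a : {poly R}) :
  a \is monic -> size a = n.+1 -> (size (a - 'X^n)%R <= n)%N.
Proof.
move=> am sa; have an : a`_n = 1 by move/monicP: am; rewrite lead_coefE sa.
apply/leq_sizeP => j; rewrite leq_eqVlt coefB coefXn => /orP[/eqP<-|nj].
  by rewrite an eqxx subrr.
by rewrite nth_default ?sa// gtn_eqF// subrr.
Qed.

Lemma row_of_pairK chi ab : half_factor n chi ab -> pair_of_row (row_of_pair ab) = ab.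
Proof.
case: ab => a b [/= [am sa] sb _ _].
rewrite /pair_of_row /row_of_pair row_mxKl row_mxKr !poly_rV_K//=.
  by rewrite addrC subrK.
exact: size_monic_subXn.
Qed.

Lemma smpoly_rVpoly d k (U : set 'rV[R]_d) m (g : 'rV[R]_d -> 'rV[R]_m) : open U ->
  smmx k U g -> smpoly k U (fun x => rVpoly (g x)).
Proof.
move=> Uo sg i.
case: (ltnP i m) => im.
  apply: (Cks_eq Uo _ (sg 0 (Ordinal im))) => x _.
  exact/esym/(coef_rVpoly_ord (g x) (Ordinal im)).
apply: (Cks_eq Uo _ (Cks_cst k U 0)) => x _.
by rewrite nth_default//; apply: leq_trans im; exact: size_poly.
Qed.

Lemma smmx_poly_rV d k (U : set 'rV[R]_d) m (p : 'rV[R]_d -> {poly R}) : open U ->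
  smpoly k U p -> smmx k U (fun x => poly_rV (p x) : 'rV[R]_m).
Proof.
by move=> Uo sp i j; apply: (Cks_eq Uo _ (sp j)) => x _; rewrite mxE.
Qed.

Lemma smpoly_pair_of_row d k (U : set 'rV[R]_d) (g : 'rV[R]_d -> 'rV[R]_(n + n)) :
  open U -> smmx k U g -> smpoly k U (fun x => (pair_of_row (g x)).1) /\
    smpoly k U (fun x => (pair_of_row (g x)).2).
Proof.
move=> Uo sg; split.
  apply: smpolyD => //; first exact: smpoly_cst.
  apply: smpoly_rVpoly => // i j.
  by apply: (Cks_eq Uo _ (sg i (lshift n j))) => x _; rewrite mxE.
apply: smpoly_rVpoly => // i j.
by apply: (Cks_eq Uo _ (sg i (rshift n j))) => x _; rewrite mxE.
Qed.

Lemma Cks_sqmod_horner d k (U : set 'rV[R]_d) (a b : 'rV[R]_d -> {poly R}) N z :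
  open U -> (forall x, (size (a x) <= N)%N) -> (forall x, (size (b x) <= N)%N) ->
  smpoly k U a -> smpoly k U b ->
  Cks k U (fun x => sqmod (cpoly (a x) (b x)).[z]).
Proof.
move=> Uo sza szb sa sb.
pose r x := \sum_(l < N) ((a x)`_l * complex.Re (z ^+ l) - (b x)`_l * complex.Im (z ^+ l)).
pose s x := \sum_(l < N) ((a x)`_l * complex.Im (z ^+ l) + (b x)`_l * complex.Re (z ^+ l)).
apply: (Cks_eq Uo (f := fun x => r x * r x + s x * s x)).
  by move=> x _; rewrite (ReIm_horner_cpoly _ (sza x) (szb x)) /sqmod /= !expr2.
have sr : Cks k U r.
  apply: Cks_sum => // l _; apply: CksD => //; last apply: CksN => //;
  by apply: CksM => //; exact: Cks_cst.
have ss : Cks k U s.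
  by apply: Cks_sum => // l _; apply: CksD => //; apply: CksM => //; exact: Cks_cst.
by apply: CksD => //; exact: CksM.
Qed.

End PolyVectors.

(** * Continuity of the half factor *)

Section HalfFactorSmooth.
Context {R : realType}.

Lemma mx_norm_le m n (A : 'M[R]_(m, n)) (C : R) : 0 <= C ->
  (forall i j, `|A i j| <= C) -> `|A| <= C.
Proof.
move=> C0 AC; rewrite /Num.Def.normr/= mx_normrE.
by apply: bigmax_le => // -[i j] _; exact: AC.
Qed.

(** The coefficients are the values at the nodes 0, ..., n - 1 times the inverse of a Vandermonde
    matrix; S is the sum of the absolute values of the entries of that inverse. *)
Lemma poly_rV_bound n : exists2 S : R, 0 <= S & forall (g : {poly R}) (B : R),
  (size g <= n)%N -> (forall i : 'I_n, `|g.[i%:R]| <= B) ->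
  forall j, `|(poly_rV g : 'rV[R]_n) 0 j| <= S * B.
Proof.
pose t := \row_(j < n) (j%:R : R); pose W := Vandermonde n t.
have Wu : W \in unitmx.
  rewrite unitmxE unitfE det_Vandermonde; apply/prodf_neq0 => i _.
  apply/prodf_neq0 => j ij; rewrite !mxE subr_eq0 eqr_nat neq_ltn ij orbT.
  by [].
exists (\sum_i \sum_j `|invmx W i j|).
  by apply: sumr_ge0 => i _; apply: sumr_ge0.
move=> g B sg gB j.
have -> : (poly_rV g : 'rV[R]_n) = (\row_i g.[i%:R]) *m invmx W.
  apply: (canRL (mulmxK Wu)); apply/rowP => i; rewrite !mxE.
  rewrite (horner_coef_wide _ sg); apply: eq_bigr => l _.
  by rewrite !mxE.
rewrite mxE mulr_suml (le_trans (ler_norm_sum _ _ _))//; apply: ler_sum => l _.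
rewrite mxE normrM mulrC.
apply: (@le_trans _ _ (`|invmx W l j| * B)); first by apply: ler_wpM2l.
apply: ler_wpM2r; first exact: le_trans (gB l).
by rewrite (bigD1 j)//= lerDl sumr_ge0.
Qed.

Section Continuity.
Context {d n : nat}.
Variables (U : set 'rV[R]_d) (chi : 'rV[R]_d -> {poly R}).
Variable ab : 'rV[R]_d -> {poly R} * {poly R}.
Hypothesis Uo : open U.
Hypothesis hab : forall x, U x -> half_factor n (chi x) (ab x).

Lemma Cks_horner_wide k (p : 'rV[R]_d -> {poly R}) N t : smpoly k U p ->
  (forall x, U x -> (size (p x) <= N)%N) -> Cks k U (fun x => (p x).[t]).
Proof.
move=> sp szp; apply: (Cks_eq Uo (f := fun x => \sum_(l < N) (p x)`_l * t ^+ l)).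
  by move=> x Ux; rewrite (horner_coef_wide _ (szp x Ux)).
by apply: Cks_sum => // l _; apply: CksM => //; exact: Cks_cst.
Qed.

Lemma size_half_factor_chi x : U x -> (size (chi x) <= n.*2.+1)%N.
Proof.
move=> Ux; case: (hab Ux) => -[am sa] sb <- _.
apply: leq_trans (size_polyD _ _) _; rewrite geq_max; apply/andP; split.
  by apply: leq_trans (size_polyMleq _ _) _; rewrite sa addSn addnS addnn.
apply: leq_trans (size_polyMleq _ _) _.
have h : (size (ab x).2 + size (ab x).2 <= n.*2)%N by rewrite -addnn leq_add.
exact: leq_trans (leq_trans (leq_pred _) h) (leqnSn _).
Qed.

Hypothesis chi0 : smpoly 0 U chi.

(** At a real t, a(t)^2 + b(t)^2 = chi(t) bounds both values; values at n nodes bound the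
    coefficients. *)
Lemma half_factor_bounded x : U x ->
  exists M : R, \forall y \near x, `|row_of_pair (n := n) (ab y)| <= M.
Proof.
move=> Ux; have [S S0 HS] := poly_rV_bound n.
(* Near x the value of chi at a node moves by at most 1, and r^2 <= |chi| + 1 implies |r| <= |chi| +
   2, without square roots. The power of t pays for removing 'X^n from a; the sum over the nodes
   dominates each of its terms. *)
pose B : R := \sum_(t < n) (`|(chi x).[t%:R]| + `|t%:R ^+ n| + 3).
have B0 : 0 <= B by apply: sumr_ge0 => t _; rewrite !addr_ge0.
exists (S * B).
have near_chi : \forall y \near x, forall t : 'I_n, `|(chi x).[t%:R] - (chi y).[t%:R]| <= 1.
  apply: (@filter_forall _ _ _ (nbhs x)) => t.
  have cc : {for x, continuous (fun y => (chi y).[t%:R])}.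
    exact: (Cks_horner_wide _ chi0 size_half_factor_chi).
  by have /cvgrPdist_le/(_ _ ltr01) := cc.
have near_U : nbhs x U by exact: open_nbhs_nbhs.
have imp y : (forall t : 'I_n, `|(chi x).[t%:R] - (chi y).[t%:R]| <= 1) -> U y ->
    `|row_of_pair (n := n) (ab y)| <= S * B.
  move=> hy Uy; have [[am sa] sb E _] := hab Uy.
  have bnd (t : 'I_n) : `|(ab y).1.[t%:R]| + `|t%:R ^+ n| <= B /\ `|(ab y).2.[t%:R]| <= B.
    have Bt : `|(chi x).[t%:R]| + `|t%:R ^+ n| + 3 <= B.
      by rewrite /B (bigD1 t)//= lerDl sumr_ge0// => ? _; rewrite !addr_ge0.
    have := hy t; move: (congr1 (horner^~ t%:R) E); rewrite /= hornerD !horner_exp.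
    move: Bt; move: (chi x).[_] (chi y).[_] (ab y).1.[_] (ab y).2.[_] => cx cy a b.
    have : 0 <= `|t%:R ^+ n : R| by [].
    move: `|t%:R ^+ n| => T T0 Bt ab1 /ler_normlP[h1 h2].
    have hcx := ler_norm cx.
    have le1 (r : R) : r ^+ 2 <= `|cx| + 1 -> `|r| <= `|cx| + 2.
      move=> hr; rewrite -(ler_pXn2r (n := 2)) ?nnegrE ?addr_ge0//.
      by rewrite real_normK ?num_real//; have := normr_ge0 cx; nra.
    have ha : `|a| <= `|cx| + 2 by apply: le1; have := sqr_ge0 b; lra.
    have hb : `|b| <= `|cx| + 2 by apply: le1; have := sqr_ge0 a; lra.
    by split; lra.
  apply: mx_norm_le => [|i j]; first by rewrite mulr_ge0.
  rewrite (ord1 i) /row_of_pair; case: (split_ordP j) => l ->.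
    rewrite row_mxEl; apply: HS => [|t]; first exact: size_monic_subXn.
    rewrite hornerD hornerN hornerXn (le_trans (ler_normB _ _))//.
    by have [] := bnd t.
  by rewrite row_mxEr; apply: HS => // t; have [] := bnd t.
exact: (@filterS2 _ (nbhs x) _ _ _ _ imp near_chi near_U).
Qed.

(** A cluster value w inherits two closed conditions: the equation with right-hand side chi x, and
    the lower bound for |p(z)|^2 when Im z < 0. The bound excludes roots below the axis; a real root
    would be one of chi x, hence of the half factor [ab x], whose roots are not real. So w is the
    half factor of chi x, and uniqueness applies. *)
Lemma half_factor_continuous x : U x ->
  {for x, continuous (fun y => row_of_pair (n := n) (ab y))}.
Proof.
move=> Ux; have [M hM] := half_factor_bounded Ux.
apply: (continuous_cluster_uniq hM) => w cw.
have near_U : nbhs x U by exact: open_nbhs_nbhs.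
have szp (v : 'rV[R]_(n + n)) : (size (pair_of_row v).1 <= n.+1)%N.
  by rewrite (pair_of_row1 v).2.
have szq (v : 'rV[R]_(n + n)) : (size (pair_of_row v).2 <= n.+1)%N.
  exact: leq_trans (size_rVpoly _) _.
have sid : smmx 0 setT (fun v : 'rV[R]_(n + n) => v).
  by move=> i j v _; exact: coord_continuous.
have [s1 s2] := smpoly_pair_of_row openT sid.
have E : (pair_of_row w).1 ^+ 2 + (pair_of_row w).2 ^+ 2 = chi x.
  apply/polyP => l.
  have ss : smpoly 0 setT (fun v : 'rV[R]_(n + n) =>
      (pair_of_row v).1 ^+ 2 + (pair_of_row v).2 ^+ 2).
    apply: smpolyD; first exact: openT.
      exact: (smpolyM openT s1 s1).
    exact: (smpolyM openT s2 s2).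
  apply: (cluster_eq (h := fun v => ((pair_of_row v).1 ^+ 2 + (pair_of_row v).2 ^+ 2)`_l)
    (g := fun y => (chi y)`_l) _ _ _ cw).
  - by move=> v; exact: ss.
  - exact: chi0.
  - apply: (@filterS _ (nbhs x) _ U) => // y Uy.
    by rewrite (row_of_pairK (hab Uy)); case: (hab Uy) => _ _ <-.
have ge z : complex.Im z < 0 ->
    (complex.Im z ^+ 2) ^+ n <= sqmod (cpoly (pair_of_row w).1 (pair_of_row w).2).[z].
  move=> z0; apply: (cluster_ge (h := fun v =>
     sqmod (cpoly (pair_of_row v).1 (pair_of_row v).2).[z]) _ _ cw).
    by move=> v; apply: (Cks_sqmod_horner (N := n.+1) z openT szp szq s1 s2).
  apply: (@filterS _ (nbhs x) _ U) => // y Uy.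
  by rewrite (row_of_pairK (hab Uy)); exact: half_factor_sqmod_ge (hab Uy) z0.
have hw : half_factor n (chi x) (pair_of_row w).
  split=> //; [exact: pair_of_row1|exact: size_rVpoly|move=> z rz].
  rewrite lt_neqAle leNgt; apply/andP; split; last first.
    apply/negP => z0; have := ge _ z0.
    rewrite (rootP rz) /sqmod /= expr0n addr0 leNgt exprn_gt0//.
    by rewrite exprn_even_gt0//= lt_eqF.
  apply/negP => /eqP z0.
  have /rootP : root (map_poly (real_complex R) (chi x)) z.
    by rewrite -E -cpoly_mul_conj rootM rz.
  case: (hab Ux) => _ _ <- hr; rewrite -cpoly_mul_conj => /rootP.
  have zc : (z^*)%C = z by case: z z0 {rz} => u v /= <-; rewrite oppr0.
  by rewrite rootM root_cpolyN zc orbb => /hr; rewrite -z0 ltxx.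
by rewrite -(half_factor_uniq hw (hab Ux)) pair_of_rowK.
Qed.

End Continuity.
End HalfFactorSmooth.

(** * Smoothness of the half factor: the Sylvester map *)

Section HalfFactorSmooth.
Context {R : realType} {n : nat}.

(** The map (u, v) -> u A + v B on pairs of polynomials of degree less than n; up to the ordering of
    bases its matrix is a Sylvester matrix, invertible for coprime A and B of the degrees met
    here. *)
Definition sylvester_map (A B : {poly R}) (w : 'rV[R]_(n + n)) : 'rV[R]_(n + n) :=
  poly_rV (rVpoly (lsubmx w) * A + rVpoly (rsubmx w) * B).

Fact sylvester_map_is_linear A B : linear (sylvester_map A B).
Proof.
move=> k u v; rewrite /sylvester_map !linearP !mulrDl -!scalerAl.
by rewrite addrACA -scalerDr linearP.
Qed.

HB.instance Definition _ A B := GRing.isLinear.Build R 'rV[R]_(n + n) 'rV[R]_(n + n)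
  _ (sylvester_map A B) (sylvester_map_is_linear A B).

(** The argument s is a sum u + v of two coordinate vectors. The first component of its pair
    contains 'X^n only once, and the added 'X^n restores the sum of two monic polynomials. *)
Definition sylvester_lin (s : 'rV[R]_(n + n)) : 'M[R]_(n + n) :=
  lin1_mx (sylvester_map ((pair_of_row s).1 + 'X^n) (pair_of_row s).2).

Lemma smmx_sylvester_lin e k (U : set 'rV[R]_e) (g : 'rV[R]_e -> 'rV[R]_(n + n)) :
  open U -> smmx k U g -> smmx k U (fun x => sylvester_lin (g x)).
Proof.
move=> Uo sg i j; have [s1 s2] := smpoly_pair_of_row Uo sg.
suff H : smmx k U (fun x => sylvester_map ((pair_of_row (g x)).1 + 'X^n)
    (pair_of_row (g x)).2 (delta_mx 0 i)).
  by apply: (Cks_eq Uo _ (H 0 j)) => x _; rewrite [RHS]mxE.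
apply: smmx_poly_rV => //; apply: smpolyD => //; apply: smpolyM => //;
  try exact: smpoly_cst.
by apply: smpolyD => //; exact: smpoly_cst.
Qed.

Lemma sylvester_linE (u v : 'rV[R]_(n + n)) :
  (u - v) *m sylvester_lin (u + v) =
  poly_rV (((pair_of_row u).1 ^+ 2 + (pair_of_row u).2 ^+ 2)
           - ((pair_of_row v).1 ^+ 2 + (pair_of_row v).2 ^+ 2)).
Proof.
rewrite mul_rV_lin1 /= /sylvester_map /pair_of_row /=; congr poly_rV.
rewrite !linearB !linearD /=.
by move: (rVpoly _) (rVpoly (lsubmx v)) (rVpoly (rsubmx u)) (rVpoly _) 'X^n => *; ring.
Qed.

(** A kernel vector gives p a + q b = 0 with deg p, deg q < n. Since a is coprime to b it divides q,
    and deg a = n forces q = 0, then p = 0. The doubled argument only contributes a factor 2. *)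
Lemma sylvester_lin_unit chi (w : 'rV[R]_(n + n)) : half_factor n chi (pair_of_row w) ->
  sylvester_lin (w + w) \in unitmx.
Proof.
move=> hw; have cop := half_factor_coprime hw; case: hw => -[am sa] sb _ _.
rewrite -row_free_unit -kermx_eq0; apply/eqP/row_matrixP => i; rewrite row0.
have : row i (kermx (sylvester_lin (w + w))) *m sylvester_lin (w + w) = 0.
  by rewrite -row_mul mulmx_ker row0.
move: (row _ _) => v; rewrite mul_rV_lin1 /= /sylvester_map.
set a := (pair_of_row w).1 in am sa cop; set b := (pair_of_row w).2 in sb cop.
have -> : (pair_of_row (w + w)).1 + 'X^n = 2%:R *: a.
  rewrite /a /= (linearD lsubmx) (linearD rVpoly) /= scaler_nat mulr2n.
  by move: (rVpoly _) 'X^n => t u; ring.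
have -> : rVpoly (rsubmx (w + w)) = 2%:R *: b.
  by rewrite /b /= (linearD rsubmx) (linearD rVpoly) /= scaler_nat mulr2n.
rewrite -!scalerAr -scalerDr linearZ /= => /eqP; rewrite scaler_eq0 pnatr_eq0 /=.
set p := rVpoly (lsubmx v); set q := rVpoly (rsubmx v).
move=> /eqP /(congr1 rVpoly); rewrite linear0 poly_rV_K; last first.
  have sp : (size p <= n)%N by exact: size_rVpoly.
  have sq : (size q <= n)%N by exact: size_rVpoly.
  apply: leq_trans (size_polyD _ _) _; rewrite geq_max; apply/andP; split.
    apply: leq_trans (size_polyMleq _ _) _.
    by rewrite sa addnS /= leq_add2r.
  apply: leq_trans (size_polyMleq _ _) _.
  by apply: leq_trans (leq_pred _) _; exact: leq_add.
move=> E.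
have a0 : a != 0 by exact: monic_neq0.
have q0 : q = 0.
  apply/eqP; apply: contraTT (size_rVpoly (rsubmx v)) => q0; rewrite -ltnNge -sa.
  apply: dvdp_leq => //; rewrite -(Gauss_dvdpl _ cop).
  have -> : q * b = - p * a by apply/eqP; rewrite mulNr -addr_eq0 addrC E.
  exact: dvdp_mull.
have p0 : p = 0.
  by move/eqP: E; rewrite q0 mul0r addr0 mulf_eq0 (negbTE a0) orbF => /eqP.
rewrite -[v]hsubmxK -[lsubmx v]rVpolyK -[rsubmx v]rVpolyK -/p -/q p0 q0 !linear0.
by rewrite row_mx0.
Qed.

Lemma half_factor_smooth d (U : set 'rV[R]_d) chi ab : open U ->
  (forall x, U x -> half_factor n (chi x) (ab x)) ->
  (forall k, smpoly k U chi) ->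
  forall k, smpoly k U (fun x => (ab x).1) /\ smpoly k U (fun x => (ab x).2).
Proof.
move=> Uo hab schi k.
pose f x := row_of_pair (n := n) (ab x).
have fK x : U x -> pair_of_row (f x) = ab x.
  by move=> Ux; exact: row_of_pairK (hab x Ux).
have sf : smmx k U f.
  (* [poly_rV] keeps the coefficients of chi below degree 2n; the missing leading coefficient is the
     constant 1. *)
  apply: (@quadratic_bootstrap _ _ _ _ f (fun x => poly_rV (chi x)) sylvester_lin) => //.
  - by move=> x Ux; exact: (half_factor_continuous Uo hab (schi 0) Ux).
  - by move=> l; exact: smmx_poly_rV.
  - by move=> *; exact: smmx_sylvester_lin.
  - move=> x y Ux Uy; rewrite sylvester_linE !fK// linearB/=.
    by case: (hab x Ux) (hab y Uy) => _ _ -> _ [_ _ -> _].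
  - by move=> x Ux; apply: (sylvester_lin_unit (chi := chi x)); rewrite fK//; exact: hab.
have [s1 s2] := smpoly_pair_of_row Uo sf.
by split; [apply: smpoly_eq s1|apply: smpoly_eq s2] => // x Ux; rewrite fK.
Qed.

End HalfFactorSmooth.

(** * The square root of -1 attached to a real matrix of even size *)

Section ComplexStructure.
Context {R : realType}.

(** A half factor is unique when it exists, so [xget] makes no choice there; (0, 0) is the default
    elsewhere. *)
Definition half_part n (chi : {poly R}) : {poly R} * {poly R} :=
  xget (0, 0) [set ab | half_factor n chi ab].

Definition no_real_root m (A : 'M[R]_m) := forall t, ~~ root (char_poly A) t.

Lemma half_partP n (A : 'M[R]_(n.*2)) : no_real_root A ->
  half_factor n (char_poly A) (half_part n (char_poly A)).
Proof.
move=> nr; have [ab hab] := half_factor_exists (char_poly_monic A) (size_char_poly A) nr.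
exact: (@xgetPex _ (0, 0) [set ab | half_factor n (char_poly A) ab] (ex_intro _ ab hab)).
Qed.

(** [horner_mx] asks for a matrix of positive size; in size 0 there is a single matrix. *)
Definition imag_of n : 'M[R]_(n.*2) -> 'M[R]_(n.*2) :=
  match n return 'M[R]_(n.*2) -> 'M[R]_(n.*2) with
  | 0 => id
  | n'.+1 => fun A => @imag_mx R n'.*2.+1 (half_part n'.+1 (char_poly A)) A
  end.

Lemma imag_ofK n (A : 'M[R]_(n.*2)) : no_real_root A ->
  imag_of A *m imag_of A = - 1%:M.
Proof.
case: n A => [|n] A nr; first by rewrite !flatmx0.
exact: imag_mxK (half_partP nr).
Qed.

Lemma imag_of_conj n (A B P : 'M[R]_(n.*2)) : no_real_root A ->
  P \in unitmx -> P *m A = B *m P -> P *m imag_of A = imag_of B *m P.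
Proof.
case: n A B P => [|n] A B P nr Pu PA; first by rewrite !flatmx0.
rewrite /imag_of -(char_poly_conj Pu PA).
exact: imag_mx_conj (half_partP nr) Pu PA.
Qed.

Lemma imag_of_form n (A W G : 'M[R]_(n.*2)) : no_real_root A ->
  G \in unitmx -> G^T = G -> W^T = - W -> A *m G = W ->
  imag_of A *m W *m (imag_of A)^T = W.
Proof.
case: n A W G => [|n] A W G nr Gu GT WT AG; first by rewrite !flatmx0.
apply: (imag_mx_form _ (half_partP nr) Gu GT WT AG).
by rewrite -doubleS odd_double.
Qed.

Lemma smmx_imag_of d n (U : set 'rV[R]_d) (A : 'rV[R]_d -> 'M[R]_(n.*2)) : open U ->
  (forall x, U x -> no_real_root (A x)) -> (forall k, smmx k U A) ->
  forall k, smmx k U (fun x => imag_of (A x)).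
Proof.
move=> Uo nr sA k.
case: n A nr sA => [|n] A nr sA; first by move=> [].
pose ab x := half_part n.+1 (char_poly (A x)).
have hab x : U x -> half_factor n.+1 (char_poly (A x)) (ab x).
  by move=> Ux; apply: half_partP; exact: nr.
have [|s1 s2] := half_factor_smooth Uo hab _ k.
  by move=> l; exact: smpoly_char_poly (sA l).
have sz1 x : U x -> (size (ab x).1 <= n.+2)%N by move=> /hab[[_ ->]].
have sz2 x : U x -> (size (ab x).2 <= n.+1)%N by move=> /hab[].
have h1 : smmx k U (fun x => @horner_mx R n.*2.+1 (A x) (ab x).1).
  exact: (@smmx_horner _ _ _ _ Uo n.*2.+1 A _ _ sz1 (sA k) s1).
have h2 : smmx k U (fun x => @horner_mx R n.*2.+1 (A x) (ab x).2).
  exact: (@smmx_horner _ _ _ _ Uo n.*2.+1 A _ _ sz2 (sA k) s2).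
apply: (smmxN Uo); apply: (smmxM Uo) => //; apply: (smmx_inv Uo) => // x Ux.
exact: half_factor_mx_unit (hab x Ux).
Qed.

End ComplexStructure.

(** * Charts, Jacobians and the form omega *)

Section Jacobian.
Context {R : realType}.

Lemma near_eq_jacobian d e (f g : 'rV[R]_d -> 'rV[R]_e) p :
  (\near p, f p = g p) -> differentiable f p -> 'J f p = 'J g p.
Proof.
move=> fg df; have dg := near_eq_differentiable fg df.
apply/row_matrixP => i; apply: (etrans (@row_jacobian _ _ _ f p i df)).
apply: (etrans (near_eq_derive _ fg)); exact/esym/(@row_jacobian _ _ _ g p i dg).
Qed.

Lemma jacobian_comp d e h (f : 'rV[R]_d -> 'rV[R]_e) (g : 'rV[R]_e -> 'rV[R]_h) p :
  differentiable f p -> differentiable g (f p) ->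
  'J (g \o f) p = 'J f p *m 'J g (f p).
Proof.
move=> df dg; have dgf := differentiable_comp df dg.
apply/row_matrixP => i; apply: (etrans (@row_jacobian _ _ _ (g \o f) p i dgf)).
rewrite row_mul (@row_jacobian _ _ _ f p i df) (deriveE _ dgf) (diff_comp df dg) /=.
by rewrite -(deriveE _ df) -(deriveE _ dg) (deriveEjacobian _ dg).
Qed.

Lemma jacobian_id d (f : 'rV[R]_d -> 'rV[R]_d) p :
  (\forall y \near p, f y = y) -> 'J f p = 1%:M.
Proof.
move=> fid; have fid' : \forall y \near p, id y = f y.
  by apply: (@filterS _ (nbhs p) _ _ _ _ fid) => y ->.
have did : differentiable (@id 'rV[R]_d) p by [].
rewrite -(near_eq_jacobian fid' did).
by apply/row_matrixP => i; rewrite (@row_jacobian _ _ _ id p i did) derive_id row1.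
Qed.

End Jacobian.

(* Locked, since unification diverges when it unfolds two distinct Jacobians. *)
HB.lock Definition mjac (R : realType) d e (M : manifold R d) (N : manifold R e)
    (c : chart R M d) (c' : chart R N e) (phi : M -> N) (x : M) : 'M[R]_(d, e) :=
  'J (c' \o phi \o cinv c) (c x).

Section Charts.
Context {R : realType}.

Lemma open_chart_image d (M : manifold R d) (c : chart R M d) (U : set M) :
  open U -> open (c @` (U `&` cdom c)).
Proof.
move=> Uo; rewrite openE => _ [x [Ux cx] <-].
have codx : (c @` cdom c) (c x) by exists x.
have n1 : nbhs (c x) (c @` cdom c) by apply: open_nbhs_nbhs; split; [exact: ccod_open|].
have n2 : nbhs (c x) (cinv c @^-1` U).
  apply: (cinv_continuous codx); rewrite cmapK//; exact: open_nbhs_nbhs.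
have imp y : (c @` cdom c) y -> (cinv c @^-1` U) y -> (c @` (U `&` cdom c)) y.
  by move=> [z cz <-]; rewrite /preimage /= cmapK// => Uz; exists z.
exact: (@filterS2 _ (nbhs (c x)) _ _ _ _ imp n1 n2).
Qed.

Lemma near_chart d (M : manifold R d) (c : chart R M d) (x : M) (P : set M) :
  cdom c x -> (\forall y \near x, P y) ->
  \forall y \near c x, [/\ P (cinv c y), cdom c (cinv c y) & c (cinv c y) = y].
Proof.
move=> cx Px.
have Px' : nbhs x (interior P) by exact/nbhs_interior.
have : nbhs (c x) (c @` (interior P `&` cdom c)).
  apply: open_nbhs_nbhs; split; first exact: open_chart_image (open_interior P).
  by exists x => //; split=> //; exact: nbhs_singleton.
apply: (@filterS _ (nbhs (c x))) => _ [z [Pz cz] <-].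
by rewrite !cmapK//; split=> //; exact: interior_subset.
Qed.

Lemma smooth_map_id d (M : manifold R d) : smooth_map (@id M).
Proof.
split; first by move=> x; exact: cvg_id.
by move=> c c' ca ca'; exact: atlas_compatible.
Qed.

Lemma smooth_map_chart d e (M : manifold R d) (N : manifold R e) (phi : M -> N)
    (c : chart R M d) (c' : chart R N e) :
  smooth_map phi -> atlas c -> atlas c' ->
  open (c @` (cdom c `&` phi @^-1` cdom c')) /\
  forall k, smmx k (c @` (cdom c `&` phi @^-1` cdom c')) (c' \o phi \o cinv c).
Proof.
move=> [pc ps] ca ca'.
have oV : open (c @` (cdom c `&` phi @^-1` cdom c')).
  rewrite setIC; apply: open_chart_image; apply: open_comp; last exact: cdom_open.
  by move=> y _; exact: pc.
by split=> //; apply/smooth_onP => //; exact: ps.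
Qed.

Lemma differentiable_chart d e (M : manifold R d) (N : manifold R e) (phi : M -> N)
    (c : chart R M d) (c' : chart R N e) (x : M) :
  smooth_map phi -> atlas c -> atlas c' -> cdom c x -> cdom c' (phi x) ->
  differentiable (c' \o phi \o cinv c) (c x).
Proof.
move=> ps ca ca' cx cx'; have [oV s] := smooth_map_chart ps ca ca'.
by apply: (smmx_differentiable (s 1)); exists x.
Qed.

(** Chain rule, with the factors in the order of row vectors. The intermediate chart cancels only on
    its domain, hence the passage to functions that agree near [c x]. *)
Lemma mjac_comp d e h (M : manifold R d) (N : manifold R e) (P : manifold R h)
    (phi : M -> N) (psi : N -> P) c c' c'' (x : M) :
  smooth_map phi -> smooth_map psi -> atlas c -> atlas c' -> atlas c'' ->
  cdom c x -> cdom c' (phi x) -> cdom c'' (psi (phi x)) ->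
  mjac c c'' (psi \o phi) x = mjac c c' phi x *m mjac c' c'' psi (phi x).
Proof.
move=> sphi spsi ca ca' ca'' cx cx' cx''.
have d1 := differentiable_chart sphi ca ca' cx cx'.
have d2 := differentiable_chart spsi ca' ca'' cx' cx''.
have px : (c' \o phi \o cinv c) (c x) = c' (phi x) by rewrite /= cmapK.
have d2' : differentiable (c'' \o psi \o cinv c') ((c' \o phi \o cinv c) (c x)).
  by rewrite px.
pose f := c' \o phi \o cinv c; pose g := c'' \o psi \o cinv c'.
have n1 : \forall y \near x, cdom c' (phi y).
  by apply: sphi.1; apply: open_nbhs_nbhs; split=> //; exact: cdom_open.
have nfg : \forall y \near c x, (g \o f) y = (c'' \o (psi \o phi) \o cinv c) y.
  apply: (@filterS _ (nbhs (c x)) _ _ _ _ (near_chart cx n1)) => y [cy _ _].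
  by rewrite /g /f /= cmapK.
have dgf : differentiable (g \o f) (c x) by exact: differentiable_comp d1 d2'.
rewrite !mjac.unlock; apply: (etrans (esym (near_eq_jacobian nfg dgf))).
apply: (etrans (jacobian_comp d1 d2')).
exact: (congr1 (fun z => 'J f (c x) *m 'J g z) px).
Qed.

Lemma mjac_id d (M : manifold R d) (c : chart R M d) (x : M) : cdom c x ->
  mjac c c id x = 1%:M.
Proof.
move=> cx; rewrite mjac.unlock; apply: jacobian_id.
have n1 : \forall y \near x, True by exact: filterT.
by apply: (@filterS _ (nbhs (c x)) _ _ _ _ (near_chart cx n1)) => y [_ _ /=].
Qed.

Lemma mjac_unit d (M : manifold R d) (c c' : chart R M d) (x : M) :
  atlas c -> atlas c' -> cdom c x -> cdom c' x -> mjac c c' id x \in unitmx.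
Proof.
move=> ca ca' cx cx'.
have := mjac_comp (smooth_map_id M) (smooth_map_id M) ca ca' ca cx cx' cx.
by rewrite (mjac_id cx) => /esym/mulmx1_unit[].
Qed.

Lemma tangent_mapE d e (M : manifold R d) (N : manifold R e) (phi : M -> N) (x : M) :
  tangent_map phi x = mjac (chart_at x) (chart_at (phi x)) phi x.
Proof. by rewrite mjac.unlock. Qed.

Lemma tangent_map_unit d (M N : manifold R d) (phi : M -> N) (x : M) :
  diffeomorphism phi -> tangent_map phi x \in unitmx.
Proof.
move=> [sphi [psi [spsi phiK psiK]]].
have cx := chart_at_dom x; have cx' := chart_at_dom (phi x).
have cx'' : cdom (chart_at x) (psi (phi x)) by rewrite phiK.
have := mjac_comp sphi spsi (chart_at_atlas x) (chart_at_atlas (phi x)) (chart_at_atlas x)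
  cx cx' cx''.
have -> : psi \o phi = id by apply/funext => y /=; rewrite phiK.
by rewrite (mjac_id cx) tangent_mapE => /esym/mulmx1_unit[].
Qed.

Lemma local_repE d (M : manifold R d) (c : chart R M d) X y :
  local_rep c X y = X (cinv c y) *m mjac (chart_at (cinv c y)) c id (cinv c y).
Proof. by rewrite mjac.unlock. Qed.

End Charts.

(* The matrix of the exterior derivative of the 1-form with components [theta],
   up to sign. *)
HB.lock Definition dform (R : realType) d (theta : 'rV[R]_d -> 'rV[R]_d) (p : 'rV[R]_d) :
  'M[R]_d := ('J theta p)^T - 'J theta p.

(** * Exterior derivative, brackets and pullback *)

Section ExteriorDerivative.
Context {R : realType}.

Lemma trmx11 (A : 'M[R]_1) : A^T = A.
Proof. by rewrite [A]mx11_scalar tr_scalar_mx. Qed.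

Lemma dform_skew d (theta : 'rV[R]_d -> 'rV[R]_d) p : (dform theta p)^T = - dform theta p.
Proof. by rewrite dform.unlock linearB /= trmxK opprB. Qed.

(** With d theta (u, v) = D_u theta (v) - D_v theta (u), this is - d theta (u, v): the sign of theta
    [P, Q] = - d theta (P, Q). *)
Lemma dformE d (theta : 'rV[R]_d -> 'rV[R]_d)
    (p u v : 'rV[R]_d) : differentiable theta p ->
  u *m dform theta p *m v^T = 'D_v theta p *m u^T - 'D_u theta p *m v^T.
Proof.
move=> dt; rewrite (deriveEjacobian v dt) (deriveEjacobian u dt) dform.unlock.
rewrite mulmxBr mulmxBl; congr (_ - _).
by rewrite -[LHS]trmx11 !trmx_mul !trmxK mulmxA.
Qed.

Lemma differentiable_tr {V : normedModType R} m n (f : V -> 'M[R]_(m, n)) x :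
  differentiable f x -> differentiable (fun y => (f y)^T) x.
Proof.
move=> df; apply: differentiable_mxP => i j.
have -> : (fun y => (f y)^T i j) = (fun y => f y j i) by apply/funext => y; rewrite mxE.
exact: differentiable_entry.
Qed.

Lemma derive_tr {V : normedModType R} m n (f : V -> 'M[R]_(m, n)) x v :
  differentiable f x -> 'D_v (fun y => (f y)^T) x = ('D_v f x)^T.
Proof.
move=> df; apply/matrixP => i j; rewrite mxE (derive_entry v i j (differentiable_tr df)).
rewrite (derive_entry v j i df); congr ('D_v _ x).
by apply/funext => y; rewrite mxE.
Qed.

(** Leibniz rule applied to P theta^T = 0. *)
Lemma derive_annihilated d (P theta : 'rV[R]_d -> 'rV[R]_d) p v :
  differentiable P p -> differentiable theta p ->
  (\forall y \near p, P y *m (theta y)^T = 0) ->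
  'D_v P p *m (theta p)^T = - (P p *m ('D_v theta p)^T).
Proof.
move=> dP dt an; apply/eqP; rewrite -addr_eq0 -(derive_tr v dt).
rewrite -(derive_mulmx v dP (differentiable_tr dt)); apply/eqP.
have an' : \forall y \near p, P y *m (theta y)^T = cst 0 y by exact: an.
by rewrite (near_eq_derive v an') derive_cst.
Qed.

(* Cartan's formula for a 1-form annihilating both vector fields. *)
Lemma bracket_dform d (P Q theta : 'rV[R]_d -> 'rV[R]_d) p :
  differentiable P p -> differentiable Q p -> differentiable theta p ->
  (\forall y \near p, P y *m (theta y)^T = 0) ->
  (\forall y \near p, Q y *m (theta y)^T = 0) ->
  (P p *m 'J Q p - Q p *m 'J P p) *m (theta p)^T = P p *m dform theta p *m (Q p)^T.
Proof.
move=> dP dQ dt aP aQ.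
rewrite (dformE _ _ dt) -(deriveEjacobian _ dQ) -(deriveEjacobian _ dP) mulmxBl.
rewrite (derive_annihilated _ dQ dt aQ) (derive_annihilated _ dP dt aP) opprK addrC.
by congr (_ - _); rewrite -[RHS]trmx11 trmx_mul trmxK.
Qed.

Section Pullback.
Context {d e : nat}.
Variables (V : set 'rV[R]_d) (Phi : 'rV[R]_d -> 'rV[R]_e).
Variables (theta : 'rV[R]_e -> 'rV[R]_e) (p : 'rV[R]_d).
Hypothesis Vo : open V.
Hypothesis Vp : V p.
Hypothesis sPhi : smmx 2 V Phi.
Hypothesis dtheta : differentiable theta (Phi p).

Definition pullback y := theta (Phi y) *m ('J Phi y)^T.

Let dPhi y : V y -> differentiable Phi y.
Proof. exact: smmx_differentiable sPhi. Qed.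

Let dJ : differentiable (fun y => 'J Phi y) p.
Proof. exact: smmx_differentiable (smmx_jacobian Vo sPhi) Vp. Qed.

Let dcomp : differentiable (theta \o Phi) p.
Proof. exact: differentiable_comp (dPhi Vp) dtheta. Qed.

Lemma differentiable_pullback : differentiable pullback p.
Proof. exact: differentiable_mulmx dcomp (differentiable_tr dJ). Qed.

Let hess (u v : 'rV[R]_d) : u *m 'D_v (fun y => 'J Phi y) p = 'D_v ('D_u Phi) p.
Proof.
have dc : differentiable (cst u : 'rV[R]_d -> 'rV[R]_d) p by exact: differentiable_cst.
have := derive_mulmx v dc dJ; rewrite derive_cst mul0mx add0r => <-.
apply: near_eq_derive; apply: (near_open Vo Vp) => y Vy.
by rewrite (deriveEjacobian u (dPhi Vy)).
Qed.

(** The exterior derivative commutes with pullback: the terms with second derivatives of Phi are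
    symmetric in u and v, so they cancel in the skew difference. *)
Lemma dform_pullback (u v : 'rV[R]_d) : u *m dform pullback p *m v^T =
  (u *m 'J Phi p) *m dform theta (Phi p) *m (v *m 'J Phi p)^T.
Proof.
have D (w : 'rV[R]_d) : 'D_w pullback p = 'D_(w *m 'J Phi p) theta (Phi p) *m ('J Phi p)^T +
    theta (Phi p) *m ('D_w (fun y => 'J Phi y) p)^T.
  have <- : 'D_w (theta \o Phi) p = 'D_(w *m 'J Phi p) theta (Phi p).
    rewrite (deriveE _ dcomp) (diff_comp (dPhi Vp) dtheta) /=.
    by rewrite -(deriveE _ (dPhi Vp)) -(deriveE _ dtheta) (deriveEjacobian _ (dPhi Vp)).
  by rewrite -(derive_tr w dJ) -(derive_mulmx w dcomp (differentiable_tr dJ)).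
have alg (Xu Xv th : 'rV[R]_e) (J Ju Jv : 'M[R]_(d, e)) : u *m Jv = v *m Ju ->
    (Xv *m J^T + th *m Jv^T) *m u^T - (Xu *m J^T + th *m Ju^T) *m v^T =
    Xv *m (u *m J)^T - Xu *m (v *m J)^T.
  move=> sym; rewrite !mulmxDl -!mulmxA -!trmx_mul sym.
  by rewrite opprD addrACA subrr addr0.
apply: (etrans (dformE u v differentiable_pullback)).
apply: (etrans (congr2 (fun a b => b *m u^T - a *m v^T) (D u) (D v))).
apply: (etrans (alg _ _ _ _ _ _ _)); last exact/esym/(dformE _ _ dtheta).
exact: (etrans (hess u v) (etrans (smmx_derive_comm u v Vo sPhi Vp) (esym (hess v u)))).
Qed.

End Pullback.
End ExteriorDerivative.

(** * The form omega as an exterior derivative *)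

Section Omega.
Context {R : realType}.

Lemma local_rep_frame d r (M : manifold R d) (c : chart R M d) (F : 'I_r -> M -> 'rV[R]_d)
    (w : 'rV[R]_r) y :
  local_rep c (fun x => w *m \matrix_(i < r) F i x) y =
  w *m \matrix_(i < r) local_rep c (F i) y.
Proof.
rewrite local_repE -mulmxA; congr (_ *m _); apply/row_matrixP => i.
by rewrite row_mul !rowK local_repE.
Qed.

Lemma smooth_vfP d (M : manifold R d) (U : set M) (X : M -> 'rV[R]_d) : open U ->
  smooth_vf U X <-> forall c k, atlas c -> smmx k (c @` (U `&` cdom c)) (local_rep c X).
Proof.
move=> Uo; split=> sX c.
  move=> k ca; have := sX c ca; rewrite smooth_onP; last exact: open_chart_image.
  exact.
by move=> ca; apply/smooth_onP; [exact: open_chart_image|move=> k; exact: sX].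
Qed.

Lemma differentiable_local_rep d (M : manifold R d) (c : chart R M d) (U : set M)
    (X : M -> 'rV[R]_d) x :
  open U -> smooth_vf U X -> atlas c -> U x -> cdom c x ->
  differentiable (local_rep c X) (c x).
Proof.
move=> Uo /(smooth_vfP _ Uo) sX ca Ux cx.
by apply: (smmx_differentiable (sX c 1 ca)); exists x.
Qed.

(** The vector u is extended with constant coefficients in a local frame. *)
Lemma section_through d r (M : manifold R d) (H : M -> 'M[R]_d) x (u : 'rV[R]_d) :
  Defs.distribution r H -> (u <= H x)%MS ->
  exists (U : set M) (X : M -> 'rV[R]_d),
    [/\ open_nbhs x U, smooth_section H U X & X x = u].
Proof.
move=> [_ /(_ x)[U [F [[Uo Ux] sF HF]]]] uH.
have /submxP[w uE] := submx_trans uH (HF x Ux).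
exists U, (fun y => w *m \matrix_(i < r) F i y); split=> //; split; last first.
  move=> y Uy; rewrite mulmx_sum_row; apply: summx_sub => i _.
  by rewrite rowK; apply: scalemx_sub; have [_] := sF i; apply.
apply/(smooth_vfP _ Uo) => c k ca.
have Vo := open_chart_image (c := c) Uo.
suff h : smmx k (c @` (U `&` cdom c)) (fun y => w *m \matrix_(i < r) local_rep c (F i) y).
  by apply: (smmx_eq Vo _ h) => y _; rewrite local_rep_frame.
apply: (smmxM Vo); first exact: smmx_cst.
move=> i j; have [/(smooth_vfP _ Uo)/(_ c k ca) sFi _] := sF i.
by apply: (Cks_eq Vo _ (sFi 0 j)) => y _; rewrite mxE.
Qed.

(** The set from which [omega] draws its value is inhabited, so that value is a genuine bracket of
    local sections, though of unknown ones. *)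
Lemma omega_spec d r (M : manifold R d) (H : M -> 'M[R]_d) x (u v : 'rV[R]_d) :
  Defs.distribution r H -> (u <= H x)%MS -> (v <= H x)%MS ->
  exists (U : set M) (X Y : M -> 'rV[R]_d),
    [/\ open_nbhs x U, smooth_section H U X, smooth_section H U Y,
        X x = u /\ Y x = v & omega H x u v = lie_bracket X Y x].
Proof.
move=> dH uH vH.
have [U [X [[Uo Ux] [sX HX] Xx]]] := section_through dH uH.
have [U' [Y [[U'o U'x] [sY HY] Yx]]] := section_through dH vH.
have sub (W W' : set M) Z : open W -> open W' -> W `<=` W' -> smooth_vf W' Z ->
    smooth_vf W Z.
  move=> Wo W'o WW' /(smooth_vfP _ W'o) sZ; apply/(smooth_vfP _ Wo) => c k ca.
  by apply: smmx_sub (sZ c k ca) => _ [z [Wz cz] <-]; exists z => //; split=> //; exact: WW'.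
have Io : open (U `&` U') by exact: openI.
apply: (@xgetPex _ 0 [set w | exists (U : set M) (X Y : M -> 'rV[R]_d),
    [/\ open_nbhs x U, smooth_section H U X, smooth_section H U Y,
        X x = u /\ Y x = v & w = lie_bracket X Y x]]).
exists (lie_bracket X Y x), (U `&` U'), X, Y; split=> //; split.
- by apply: sub sX => // y [].
- by move=> y [Uy _]; exact: HX.
- by apply: sub sY => // y [].
- by move=> y [_ Uy]; exact: HY.
Qed.

(** Cartan's formula for the pullback of theta by phi read in charts. The right-hand side no longer
    contains the unknown sections behind [omega]. A general phi covers at once the computation in an
    arbitrary chart (phi = id) and naturality. *)
Lemma omega_dform d e r (M : manifold R d) (N : manifold R e) (H : M -> 'M[R]_d)
    (phi : M -> N) (c' : chart R N e) (theta : 'rV[R]_e -> 'rV[R]_e) x (u v : 'rV[R]_d) :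
  Defs.distribution r H -> smooth_map phi -> atlas c' -> cdom c' (phi x) ->
  differentiable theta (c' (phi x)) ->
  (\forall y \near x, forall w : 'rV[R]_d, (w <= H y)%MS ->
    w *m mjac (chart_at y) c' phi y *m (theta (c' (phi y)))^T = 0) ->
  (u <= H x)%MS -> (v <= H x)%MS ->
  omega H x u v *m mjac (chart_at x) c' phi x *m (theta (c' (phi x)))^T =
  (u *m mjac (chart_at x) c' phi x) *m dform theta (c' (phi x)) *m
  (v *m mjac (chart_at x) c' phi x)^T.
Proof.
move=> dH sphi ca' cx' dth ann uH vH.
have [U [X [Y [[Uo Ux] [sX HX] [sY HY] [Xx Yx] ->]]]] := omega_spec dH uH vH.
pose c := chart_at x.
have ca : atlas c := chart_at_atlas x; have cx : cdom c x := chart_at_dom x.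
pose Phi := c' \o phi \o cinv c.
have [Vo sPhi0] := smooth_map_chart sphi ca ca'.
have sPhi : smmx 2 (c @` (cdom c `&` phi @^-1` cdom c')) Phi by exact: sPhi0.
have Vp : (c @` (cdom c `&` phi @^-1` cdom c')) (c x) by exists x.
have Phip : Phi (c x) = c' (phi x) by rewrite /Phi /= cmapK.
have dth' : differentiable theta (Phi (c x)) by rewrite Phip.
have dP := differentiable_local_rep Uo sX ca Ux cx.
have dQ := differentiable_local_rep Uo sY ca Ux cx.
have nU : \forall y \near x, U y by exact: open_nbhs_nbhs.
have nc' : \forall y \near x, cdom c' (phi y).
  by apply: sphi.1; apply: open_nbhs_nbhs; split=> //; exact: cdom_open.
(* The annihilation hypothesis is stated in the preferred chart of each y; the chain rule moves it
   to the fixed chart c, where it can be differentiated. *)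
have killed (Z : M -> 'rV[R]_d) : (forall y, U y -> (Z y <= H y)%MS) ->
    \forall y \near c x, local_rep c Z y *m (pullback Phi theta y)^T = 0.
  move=> HZ.
  have imp y : U y -> cdom c' (phi y) -> (forall w : 'rV[R]_d, (w <= H y)%MS ->
      w *m mjac (chart_at y) c' phi y *m (theta (c' (phi y)))^T = 0) ->
    Z y *m mjac (chart_at y) c' phi y *m (theta (c' (phi y)))^T = 0 /\ cdom c' (phi y).
    by move=> Uy cy h; split=> //; apply: h; exact: HZ.
  have nZ : \forall y \near x,
      Z y *m mjac (chart_at y) c' phi y *m (theta (c' (phi y)))^T = 0 /\ cdom c' (phi y).
    exact: (@filterS3 _ (nbhs x) _ _ _ _ _ imp nU nc' ann).
  apply: (@filterS _ (nbhs (c x)) _ _ _ _ (near_chart cx nZ)) => y [[h cy'] cy yE].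
  have JE : 'J Phi y = mjac c c' phi (cinv c y) by rewrite mjac.unlock yE.
  have E := mjac_comp (smooth_map_id M) sphi (chart_at_atlas (cinv c y)) ca ca'
    (chart_at_dom _) cy cy'.
  rewrite local_repE /pullback trmx_mul trmxK JE !mulmxA -(mulmxA (Z _)) -E.
  exact: h.
have repx (Z : M -> 'rV[R]_d) : local_rep c Z (c x) = Z x.
  by rewrite local_repE cmapK// mjac_id// mulmx1.
have JE : 'J Phi (c x) = mjac c c' phi x by rewrite mjac.unlock.
have B := bracket_dform dP dQ (differentiable_pullback Vo Vp sPhi dth')
  (killed X HX) (killed Y HY).
rewrite (dform_pullback Vo Vp sPhi dth') !repx Phip JE Xx Yx in B.
rewrite -[RHS]B /lie_bracket -/c !repx Xx Yx /pullback trmx_mul trmxK Phip JE.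
by rewrite mulmxA.
Qed.

End Omega.

(** * Frames and the canonical complex structure *)

Section LocalFrame.
Context {R : realType} {r : nat}.

Lemma row_free_complete (F : 'M[R]_(r, r.+1)) : row_free F ->
  exists e : 'rV[R]_r.+1, (col_mx e F : 'M[R]_(r.+1)) \in unitmx.
Proof.
move=> /eqP rF.
have /row_subPn[i iF] : ~~ ((1%:M : 'M[R]_r.+1) <= F)%MS.
  by apply/negP => /mxrankS; rewrite mxrank1 rF ltnn.
exists (row i 1%:M); rewrite -row_free_unit /row_free.
have lt : (F < row i 1%:M + F)%MS.
  rewrite /ltmx addsmxSr /=; apply/negP => h.
  by move/negP: iF; apply; exact: submx_trans (addsmxSl _ _) h.
have := rank_ltmx lt; rewrite rF => h.
rewrite addsmxE in h.
by rewrite eqn_leq rank_leq_row /=; exact: h.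
Qed.

Lemma open_chart_preimage d (M : manifold R d) (c : chart R M d) (W : set 'rV[R]_d) :
  open W -> open (cdom c `&` c @^-1` W).
Proof.
move=> Wo; rewrite openE => x [cx Wx].
have n1 : nbhs x (cdom c) by apply: open_nbhs_nbhs; split=> //; exact: cdom_open.
have n2 : nbhs x (c @^-1` W) by apply: (cmap_continuous cx); exact: open_nbhs_nbhs.
exact: (@filterI _ (nbhs x) _ _ _ n1 n2).
Qed.

(** The frame read in c is completed by one constant row e to a square matrix E, still invertible
    near x. In E E^-1 = 1 the first column of E^-1 is the annihilating form (nonzero, as e pairs
    with it to 1), and the others form a right inverse L of G, so that v = w G gives w = v L. *)
Lemma local_frame (M : manifold R r.+1) (H : M -> 'M[R]_r.+1) (c : chart R M r.+1) x :
  Defs.distribution r H -> atlas c -> cdom c x ->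
  exists (U : set M) (F : M -> 'M[R]_(r, r.+1)) (theta : 'rV[R]_r.+1 -> 'rV[R]_r.+1)
    (L : 'rV[R]_r.+1 -> 'M[R]_(r.+1, r)),
  [/\ [/\ open U, U x & U `<=` cdom c],
      forall i, smooth_section H U (fun y => row i (F y)),
      forall y, U y -> row_free (F y) /\ (F y :=: H y)%MS,
      forall k, smmx k (c @` U) theta /\ smmx k (c @` U) L &
      forall y, U y -> let G := F y *m mjac (chart_at y) c id y in
        [/\ G *m (theta (c y))^T = 0, theta (c y) != 0 & G *m L (c y) = 1%:M]].
Proof.
move=> [rkH /(_ x)[U0 [Fi [[U0o U0x] sF HF]]]] ca cx.
pose F y : 'M[R]_(r, r.+1) := \matrix_(i < r) Fi i y.
have FH y : U0 y -> row_free (F y) /\ (F y :=: H y)%MS.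
  move=> Uy.
  have le1 : (F y <= H y)%MS.
    by apply/row_subP => i; rewrite rowK; have [_] := sF i; apply.
  have le2 := HF y Uy.
  have E : (F y :=: H y)%MS by apply/eqmxP; rewrite le1.
  by split=> //; rewrite /row_free E rkH.
pose Fh y := F (cinv c y) *m mjac (chart_at (cinv c y)) c id (cinv c y).
have Fhx y : cdom c y -> Fh (c y) = F y *m mjac (chart_at y) c id y.
  by move=> cy; rewrite /Fh cmapK.
have V0o := open_chart_image (c := c) U0o.
have sFh k : smmx k (c @` (U0 `&` cdom c)) Fh.
  move=> i j; have [/(smooth_vfP _ U0o)/(_ c k ca) sFi _] := sF i.
  apply: (Cks_eq V0o _ (sFi 0 j)) => y _.
  rewrite local_repE -[RHS](_ : row i (Fh y) 0 j = _); last by rewrite mxE.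
  by rewrite /Fh row_mul rowK.
have rfh y : U0 y -> cdom c y -> row_free (Fh (c y)).
  move=> Uy cy; rewrite Fhx// /row_free mxrankMfree; first by have [] := FH y Uy.
  by rewrite row_free_unit mjac_unit//; [exact: chart_at_atlas|exact: chart_at_dom].
have [e eu] := row_free_complete (rfh x U0x cx).
pose E y : 'M[R]_r.+1 := col_mx e (Fh y).
have sE k : smmx k (c @` (U0 `&` cdom c)) E.
  move=> i j; rewrite /E.
  case: (@split_ordP 1 r i) => l ->.
    by apply: (Cks_eq V0o _ (Cks_cst k _ (e l j))) => y _; rewrite (@col_mxEu _ 1 r).
  by apply: (Cks_eq V0o _ (sFh k l j)) => y _; rewrite (@col_mxEd _ 1 r).
have VEo := open_neq0 V0o (Cks_det V0o (sE 0)).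
pose U := cdom c `&` c @^-1` (c @` (U0 `&` cdom c) `&` [set y | \det (E y) != 0]).
have UU0 y : U y -> U0 y.
  by move=> [cy [[z [Uz cz] zy] _]]; rewrite -(cmapK cy) -zy (cmapK cz).
have cU y : (c @` U) y -> (c @` (U0 `&` cdom c)) y /\ E y \in unitmx.
  by move=> [z [cz [V0z dz]] <-]; split=> //; rewrite unitmxE unitfE.
have Uo : open U by exact: open_chart_preimage.
have Vo : open (c @` U).
  have -> : U = U `&` cdom c by apply/seteqP; split=> y; [move=> Uy; split=> //; case: Uy|case].
  exact: open_chart_image.
have sEi k : smmx k (c @` U) (fun y => invmx (E y)).
  apply: (smmx_inv Vo); first by move=> y /cU[].
  by apply: smmx_sub (sE k) => y /cU[].
exists U, F, (fun y => (col 0 (invmx (E y)))^T), (fun y => @rsubmx _ _ 1 r (invmx (E y))).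
split.
- split=> //; last by move=> y [].
  by split=> //; split; [exists x|rewrite /= -unitfE -unitmxE].
- move=> i; have [sFi HFi] := sF i; split; last first.
    by move=> y /UU0 Uy; rewrite rowK; exact: HFi.
  have -> : (fun y => row i (F y)) = Fi i by apply/funext => y; rewrite rowK.
  move/(smooth_vfP _ U0o): sFi => sFi; apply/(smooth_vfP _ Uo) => c' k ca'.
  by apply: smmx_sub (sFi c' k ca') => _ [z [/UU0 Uz cz] <-]; exists z.
- by move=> y /UU0; exact: FH.
- move=> k; split=> i j.
    by apply: (Cks_eq Vo _ (sEi k j 0)) => y _; rewrite !mxE.
  by apply: (Cks_eq Vo _ (sEi k i (rshift 1 j))) => y _; rewrite mxE.
- move=> y Uy G.
  have cy : cdom c y by case: Uy.
  have [_ Eu] : (c @` (U0 `&` cdom c)) (c y) /\ E (c y) \in unitmx by apply: cU; exists y.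
  have GE : G = @dsubmx _ 1 r _ (E (c y)) by rewrite /E col_mxKd Fhx.
  have EV := mulmxV Eu.
  have Ecol : E (c y) *m col 0 (invmx (E (c y))) = col 0 1%:M by rewrite -EV !colE mulmxA.
  split.
  + rewrite trmxK GE (@mul_dsub_mx _ 1) Ecol.
    by apply/matrixP => i j; rewrite !mxE.
  + apply/eqP => /(congr1 trmx); rewrite trmxK trmx0 => th0.
    move: Ecol; rewrite th0 mulmx0 => /matrixP/(_ 0 0); rewrite !mxE => /eqP.
    by rewrite eq_sym oner_eq0.
  + rewrite GE (@mulmx_rsub _ _ _ 1) (@mul_dsub_mx _ 1) EV.
    by apply/matrixP => i j; rewrite !mxE.
Qed.

End LocalFrame.

(** * Forms and endomorphisms in a frame of one tangent space *)

Section Pointwise.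
Context {R : realType}.

(** The kernel of s contains F and has the same rank r. *)
Lemma submx_annihilator r (F : 'M[R]_(r, r.+1)) (s : 'cV[R]_r.+1) (w : 'rV[R]_r.+1) :
  row_free F -> s != 0 -> F *m s = 0 -> (w <= F)%MS = (w *m s == 0).
Proof.
move=> /eqP rF s0 Fs.
have Fk : (F <= kermx s)%MS by apply/sub_kermxP.
have rs : \rank s = 1%N.
  by apply/eqP; rewrite eqn_leq rank_leq_col lt0n mxrank_eq0.
have kF : (kermx s <= F)%MS by rewrite -(geq_leqif (mxrank_leqif_sup Fk)) mxrank_ker rs subSS subn0 rF.
apply/idP/eqP => [wF|ws]; first exact/sub_kermxP/(submx_trans wF Fk).
by apply: submx_trans kF; apply/sub_kermxP.
Qed.

Lemma bilin_mx_eq r (W W' : 'M[R]_r) :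
  (forall p q : 'rV[R]_r, p *m W *m q^T = p *m W' *m q^T) -> W = W'.
Proof.
move=> h; apply/matrixP => i j.
have := h (delta_mx 0 i) (delta_mx 0 j).
by rewrite -!rowE !trmx_delta -!colE => /matrixP/(_ 0 0); rewrite !mxE.
Qed.

Lemma unitmx_inj r (N : 'M[R]_r) : (forall p : 'rV_r, p *m N = 0 -> p = 0) -> N \in unitmx.
Proof.
move=> h; rewrite -row_free_unit -kermx_eq0; apply/eqP/row_matrixP => i; rewrite row0.
by apply: h; rewrite -row_mul mulmx_ker row0.
Qed.

Definition nu_mx r (W J : 'M[R]_r) := 2^-1 *: (W + J *m W *m J^T).

Definition g_mx r (W J : 'M[R]_r) := nu_mx W J *m J^T.

(** For row vectors, g(A u, v) = omega(u, v) reads p A G q^T = p W q^T, so G^-1 stands on the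
    right. *)
Definition A_mx r (W J : 'M[R]_r) := W *m invmx (g_mx W J).

Section NuMatrix.
Context {r : nat}.
Variables W J : 'M[R]_r.
Hypothesis WT : W^T = - W.
Hypothesis JJ : J *m J = - 1%:M.

Let JJT : J^T *m J^T = - 1%:M.
Proof. by rewrite -trmx_mul JJ linearN /= trmx1. Qed.

Lemma unitmx_J : J \in unitmx.
Proof.
have : J *m (- J) = 1%:M by rewrite mulmxN JJ opprK.
by case/mulmx1_unit.
Qed.

Lemma nu_mx_tr : (nu_mx W J)^T = - nu_mx W J.
Proof.
rewrite /nu_mx linearZ /= linearD /= !trmx_mul trmxK WT mulNmx mulmxN -opprD scalerN.
by rewrite mulmxA.
Qed.

Lemma nu_mxJ : J *m nu_mx W J *m J^T = nu_mx W J.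
Proof.
rewrite /nu_mx -scalemxAr -scalemxAl; congr (_ *: _).
rewrite mulmxDr mulmxDl !mulmxA JJ mulNmx mul1mx -(mulmxA (- W)) JJT mulmxN mulmx1.
by rewrite opprK addrC.
Qed.

Lemma g_mx_sym : (g_mx W J)^T = g_mx W J.
Proof.
rewrite /g_mx trmx_mul trmxK nu_mx_tr mulmxN -{2}nu_mxJ -!mulmxA JJT.
by rewrite !mulmxN mulmx1.
Qed.

Lemma g_mx_unit : nu_mx W J \in unitmx -> g_mx W J \in unitmx.
Proof. by move=> Nu; rewrite unitmx_mul Nu unitmx_tr unitmx_J. Qed.

End NuMatrix.

Section Frame.
Context {r : nat}.
Variables (M : manifold R r.+1) (H J : M -> 'M[R]_r.+1) (x : M).
Variables (F : 'M[R]_(r, r.+1)) (s : 'cV[R]_r.+1) (W Jh : 'M[R]_r).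

(** The rows of F are a basis of H x, the column s is a functional with kernel H x that trivialises
    the quotient, and Jh and W are the matrices of J and omega in these terms. *)
Definition frame_data := [/\ row_free F, (F :=: H x)%MS, s != 0 & F *m s = 0] /\
  [/\ F *m J x = Jh *m F, Jh *m Jh = - 1%:M, W^T = - W &
      forall p q : 'rV[R]_r, omega H x (p *m F) (q *m F) *m s = p *m W *m q^T].

Hypothesis fd : frame_data.
Hypothesis nd : nondegenerate_form (H x) (nu H J x).

Let rF : row_free F. Proof. by case: fd => -[]. Qed.
Let FH : (F :=: H x)%MS. Proof. by case: fd => -[]. Qed.
Let FJ : F *m J x = Jh *m F. Proof. by case: fd => _ []. Qed.
Let JJ : Jh *m Jh = - 1%:M. Proof. by case: fd => _ []. Qed.
Let WT : W^T = - W. Proof. by case: fd => _ []. Qed.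
Let omE (p q : 'rV[R]_r) : omega H x (p *m F) (q *m F) *m s = p *m W *m q^T.
Proof. by case: fd => _ [_ _ _]; apply. Qed.

Lemma frame_sub (w : 'rV[R]_r.+1) : (w <= H x)%MS = (w *m s == 0).
Proof. by case: fd => -[rF' <- s0 Fs] _; exact: submx_annihilator. Qed.

Lemma frame_eq_mod (u v : 'rV[R]_r.+1) : eq_mod (H x) u v = (u *m s == v *m s).
Proof. by rewrite /eq_mod frame_sub mulmxBl subr_eq0. Qed.

Lemma frameP (u : 'rV[R]_r.+1) : (u <= H x)%MS -> exists p : 'rV[R]_r, u = p *m F.
Proof. by rewrite -FH => /submxP. Qed.

Lemma nu_frame (p q : 'rV[R]_r) : nu H J x (p *m F) (q *m F) *m s = p *m nu_mx W Jh *m q^T.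
Proof.
rewrite /nu -scalemxAl mulmxDl omE -!(mulmxA _ F) FJ !mulmxA omE /nu_mx.
by rewrite -scalemxAr -scalemxAl mulmxDr mulmxDl trmx_mul !mulmxA.
Qed.

Lemma metric_frame (p q : 'rV[R]_r) :
  metric H J x (p *m F) (q *m F) *m s = p *m g_mx W Jh *m q^T.
Proof. by rewrite /metric -mulmxA FJ mulmxA nu_frame trmx_mul /g_mx !mulmxA. Qed.

Lemma nu_mx_unit : nu_mx W Jh \in unitmx.
Proof.
apply: unitmx_inj => p pN.
have pF0 : p *m F = 0.
  apply: nd; first by rewrite -FH submxMl.
  move=> v /frameP[q ->]; rewrite frame_eq_mod nu_frame pN !mul0mx.
  by [].
by apply: (row_free_inj rF); rewrite pF0 mul0mx.
Qed.

Let Gu : g_mx W Jh \in unitmx.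
Proof. exact: g_mx_unit JJ nu_mx_unit. Qed.

(** Existence: the matrix [A_mx] extended to the tangent space by [pinvmx] meets the specification,
    so [xget] does not return its default. Uniqueness on H x: the matrix of g is invertible. *)
Lemma endoA_frame : F *m endoA H J x = A_mx W Jh *m F.
Proof.
pose A0 := pinvmx F *m A_mx W Jh *m F.
have FA0 : F *m A0 = A_mx W Jh *m F.
  by rewrite /A0 -(mulmxA (pinvmx F)) (mulmxA F (pinvmx F)) (mulmxVp rF) mul1mx.
have AG : A_mx W Jh *m g_mx W Jh = W by rewrite /A_mx mulmxKV.
pose P := [set A | stablemx (H x) A /\
    forall u v : 'rV[R]_r.+1, (u <= H x)%MS -> (v <= H x)%MS ->
      eq_mod (H x) (metric H J x (u *m A) v) (omega H x u v)].
have PA0 : P A0.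
  split; first by rewrite -(eqmxMr _ FH) FA0 -FH submxMl.
  move=> u v /frameP[p ->] /frameP[q ->]; rewrite frame_eq_mod.
  by rewrite -(mulmxA p) FA0 (mulmxA p) metric_frame omE -(mulmxA p _ (g_mx W Jh)) AG.
have [st mE] : P (endoA H J x) by exact: (@xgetPex _ 0 P (ex_intro _ A0 PA0)).
have /submxP[B FB] : (F *m endoA H J x <= F)%MS.
  by apply: submx_trans (_ : (H x *m endoA H J x <= F)%MS); rewrite ?FH// submxMr// FH.
suff -> : A_mx W Jh = B by [].
apply: (canLR (mulmxK Gu)); apply: bilin_mx_eq => p q.
have inH (w : 'rV[R]_r) : (w *m F <= H x)%MS by rewrite -FH submxMl.
have := mE _ _ (inH p) (inH q).
by rewrite frame_eq_mod -(mulmxA p) FB (mulmxA p) metric_frame omE -(mulmxA p _ (g_mx W Jh)) => /eqP.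
Qed.

(** A real eigenvector w of the frame matrix gives the eigenvector w F of A on H x, with a real
    eigenvalue. *)
Lemma frame_no_real_root :
  (forall l, eigenvalue_on (H x) (endoA H J x) l -> l \isn't Num.real) ->
  no_real_root (A_mx W Jh).
Proof.
move=> nreal t; rewrite -eigenvalue_root_char; apply/negP => /eigenvalueP[w wA w0].
have : real_complex R t \isn't Num.real.
  apply: nreal; exists (complexify (w *m F)); split.
  - rewrite /complexify map_mx_eq0; apply: contraNneq w0 => wF.
    by apply/eqP/(row_free_inj rF); rewrite wF mul0mx.
  - by rewrite /complexify map_submx -FH submxMl.
  - rewrite /complexify -map_mxM -mulmxA endoA_frame mulmxA wA -scalemxAl.
    by rewrite map_mxZ.
by rewrite complex_real eqxx.
Qed.

End Frame.
End Pointwise.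

(** * The structure K and its independence of the frame *)

Section CanonicalStructure.
Context {R : realType}.

(** The frame is existentially quantified, so K depends on [H x] and [endoA H J x] alone. [xget]
    leaves K arbitrary off H x, where it carries no meaning. *)
Definition canonical_K n (M : manifold R n.*2.+1) (H J : M -> 'M[R]_(n.*2.+1)) (x : M) :
    'M[R]_(n.*2.+1) :=
  xget 0 [set K | exists (F : 'M[R]_(n.*2, n.*2.+1)) (A : 'M[R]_(n.*2)),
    [/\ row_free F, (F :=: H x)%MS, F *m endoA H J x = A *m F &
        F *m K = imag_of A *m F]].

(** The frame hidden in K differs from F by an invertible B, which conjugates the two matrices of A
    and therefore their images under [imag_of]. *)
Lemma canonical_K_frame n (M : manifold R n.*2.+1) (H J : M -> 'M[R]_(n.*2.+1)) x
    (F : 'M[R]_(n.*2, n.*2.+1)) s W Jh :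
  frame_data H J x F s W Jh -> regular_almost_CR H J ->
  F *m canonical_K H J x = imag_of (A_mx W Jh) *m F.
Proof.
move=> fd [[_ _ nd] _ nreal].
have FA := endoA_frame fd (nd x).
have nr := frame_no_real_root fd (nd x) (nreal x).
have [[rF FH _ _] _] := fd.
move: (A_mx W Jh) FA nr => A FA nr.
pose P := [set K | exists (F : 'M[R]_(n.*2, n.*2.+1)) (A : 'M[R]_(n.*2)),
    [/\ row_free F, (F :=: H x)%MS, F *m endoA H J x = A *m F &
        F *m K = imag_of A *m F]].
have exK : exists K, P K.
  exists (pinvmx F *m (imag_of A *m F)), F, A; split=> //.
  by rewrite (mulmxA F (pinvmx F)) (mulmxVp rF) mul1mx.
have [F' [A' [rF' F'H F'A F'K]]] : P (canonical_K H J x) by exact: (@xgetPex _ 0 P exK).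
have /submxP[B FB] : (F <= F')%MS by rewrite F'H FH.
have Bu : B \in unitmx.
  rewrite -row_free_unit /row_free eqn_leq rank_leq_row /=.
  by move/eqP: rF => {1}<-; rewrite FB mxrankM_maxl.
have BA : B *m A' = A *m B.
  by apply: (row_free_inj rF'); rewrite -!mulmxA -F'A -FB mulmxA -FB.
have nr' : no_real_root A' by move=> t; rewrite (char_poly_conj Bu BA); exact: nr.
by rewrite FB -(mulmxA B) F'K !mulmxA (imag_of_conj nr' Bu BA).
Qed.

Section LocalData.
Context {n : nat}.
Variables (M : manifold R n.*2.+1) (H J : M -> 'M[R]_(n.*2.+1)).
Variables (c : chart R M n.*2.+1) (U : set M) (F : M -> 'M[R]_(n.*2, n.*2.+1)).
Variables (theta : 'rV[R]_(n.*2.+1) -> 'rV[R]_(n.*2.+1)).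
Variable (L : 'rV[R]_(n.*2.+1) -> 'M[R]_(n.*2.+1, n.*2)).
Hypothesis dH : Defs.distribution n.*2 H.
Hypothesis cJ : almost_complex H J.
Hypothesis ca : atlas c.
Hypothesis Uo : open U.
Hypothesis Uc : U `<=` cdom c.
Hypothesis FH : forall y, U y -> row_free (F y) /\ (F y :=: H y)%MS.
Hypothesis st : forall k, smmx k (c @` U) theta.

Let T y := mjac (chart_at y) c id y.
Let G y := F y *m T y.

Hypothesis GtL : forall y, U y ->
  [/\ G y *m (theta (c y))^T = 0, theta (c y) != 0 & G y *m L (c y) = 1%:M].

(** The matrices of omega and J come out as explicit expressions in smooth fields, which is what the
    smoothness of K needs. [T y] passes from the preferred chart at y to the fixed chart c. *)
Lemma local_frame_data y : U y ->
  frame_data H J y (F y) (T y *m (theta (c y))^T)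
    (G y *m dform theta (c y) *m (G y)^T) (F y *m J y *m T y *m L (c y)).
Proof.
move=> Uy; have [rF FHy] := FH Uy; have [Gt t0 GL] := GtL Uy.
have cy := Uc Uy; have cy0 := chart_at_dom y.
have Tu : T y \in unitmx by apply: mjac_unit => //; exact: chart_at_atlas.
have [sJ _ JJ] := cJ.
have /submxP[B FB] : (F y *m J y <= F y)%MS.
  by rewrite FHy; apply: submx_trans (sJ y); apply: submxMr; rewrite FHy.
have EB : F y *m J y *m T y *m L (c y) = B.
  by rewrite FB -(mulmxA B) -/(G y) -mulmxA GL mulmx1.
rewrite EB; split; split => //.
- apply: contraNneq t0 => /(congr1 (mulmx (invmx (T y)))).
  by rewrite mulKmx// mulmx0 => /(congr1 trmx); rewrite trmxK trmx0 => ->.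
- by rewrite mulmxA.
- apply: (row_free_inj rF); rewrite -mulmxA -FB mulmxA -FB mulNmx mul1mx.
  apply/row_matrixP => i; rewrite !row_mul JJ; last first.
    by rewrite -FHy row_sub.
  by rewrite linearN.
- move: (G y) => g; by rewrite !trmx_mul trmxK dform_skew mulNmx mulmxN mulmxA.
- move=> p q.
  have inH (w : 'rV[R]_(n.*2)) : (w *m F y <= H y)%MS by rewrite -FHy submxMl.
  have dt : differentiable theta (c y) by apply: (smmx_differentiable (st 1)); exists y.
  have ann : \forall z \near y, forall w : 'rV[R]_(n.*2.+1), (w <= H z)%MS ->
      w *m mjac (chart_at z) c id z *m (theta (c z))^T = 0.
    apply: (near_open Uo Uy) => z Uz w; have [_ FHz] := FH Uz; have [Gz _ _] := GtL Uz.
    rewrite -FHz => /submxP[w' ->].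
    by rewrite -(mulmxA w') -mulmxA -/(T z) -/(G z) Gz mulmx0.
  rewrite mulmxA (omega_dform dH (smooth_map_id M) ca cy dt ann (inH p) (inH q)).
  by rewrite /= -/(T y) -!(mulmxA _ (F y) (T y)) -/(G y) trmx_mul !mulmxA.
Qed.

End LocalData.
End CanonicalStructure.

(** * Smoothness, compatibility with omega, and naturality of K *)

Section Main.
Context {R : realType} {n : nat}.
Implicit Types (M : manifold R n.*2.+1).

Lemma smmx_A_mx d (V : set 'rV[R]_d) r (W J : 'rV[R]_d -> 'M[R]_r) k : open V ->
  (forall y, V y -> g_mx (W y) (J y) \in unitmx) -> smmx k V W -> smmx k V J ->
  smmx k V (fun y => A_mx (W y) (J y)).
Proof.
move=> Vo gu sW sJ; apply: (smmxM Vo) => //; apply: (smmx_inv Vo) => //.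
apply: (smmxM Vo); last exact: smmx_tr.
apply: (smmxZ Vo); first exact: Cks_cst.
apply: (smmxD Vo) => //; apply: (smmxM Vo); last exact: smmx_tr.
exact: (smmxM Vo).
Qed.

Lemma regular_frame M (H J : M -> 'M[R]_(n.*2.+1)) (x : M) : regular_almost_CR H J ->
  exists F s W Jh, frame_data H J x F s W Jh.
Proof.
move=> [[dH cJ nd] _ _].
have ca := chart_at_atlas x; have cx := chart_at_dom x.
have [U [F [th [L [[Uo Ux Uc] sF FH stL GtL]]]]] := local_frame dH ca cx.
have st k : smmx k (chart_at x @` U) th by case: (stL k).
have fd := local_frame_data dH cJ ca Uo Uc FH st GtL Ux.
by eexists; eexists; eexists; eexists; exact: fd.
Qed.

(** Passing from J to K keeps F, s and W, so that [nu_frame] also applies to K and gives its form nu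
    the matrix (W + K W K^T) / 2 = W. *)
Lemma canonical_K_data M (H J : M -> 'M[R]_(n.*2.+1)) (x : M) F s W Jh :
  regular_almost_CR H J -> frame_data H J x F s W Jh ->
  let K := imag_of (A_mx W Jh) in
  frame_data H (canonical_K H J) x F s W K /\ K *m W *m K^T = W.
Proof.
move=> reg fd K; have [[_ _ nd] _ nreal] := reg.
have nr := frame_no_real_root fd (nd x) (nreal x).
have [[rF FH s0 Fs] [FJ JJ WT omE]] := fd.
split.
  split; split => //; first exact: (canonical_K_frame fd reg).
  exact: imag_ofK.
have gu := g_mx_unit JJ (nu_mx_unit fd (nd x)).
apply: (imag_of_form nr gu (g_mx_sym WT JJ) WT).
by rewrite /A_mx mulmxKV.
Qed.

Lemma canonical_K_smooth M (H J : M -> 'M[R]_(n.*2.+1)) (U' : set M) X :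
  regular_almost_CR H J -> open U' -> smooth_section H U' X ->
  smooth_vf U' (fun x => X x *m canonical_K H J x).
Proof.
move=> reg U'o [sX HX]; have [[dH cJ nd] _ nreal] := reg.
apply/(smooth_vfP _ U'o) => c k ca; apply: smmx_local => _ [x [U'x cx] <-].
have [U [F [th [L [[Uo Ux Uc] sF FH stL GtL]]]]] := local_frame dH ca cx.
have st l : smmx l (c @` U) th by case: (stL l).
have sL l : smmx l (c @` U) L by case: (stL l).
have fd y (Uy : U y) := local_frame_data dH cJ ca Uo Uc FH st GtL Uy.
pose V := c @` ((U `&` U') `&` cdom c).
have Vo : open V by apply: open_chart_image; exact: openI.
have VU : V `<=` c @` U by move=> _ [y [[Uy _] _] <-]; exists y.
exists V; first by exists x.
pose T y := mjac (chart_at (cinv c y)) c id (cinv c y).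
pose G y := F (cinv c y) *m T y.
pose Jh y := F (cinv c y) *m J (cinv c y) *m T y *m L y.
pose W y := G y *m dform th y *m (G y)^T.
have Vcinv y : V y -> [/\ U (cinv c y), U' (cinv c y) & c (cinv c y) = y].
  by move=> [z [[Uz U'z] cz] <-]; rewrite (cmapK cz); split.
have fdV y : V y -> exists s, frame_data H J (cinv c y) (F (cinv c y)) s (W y) (Jh y).
  move=> /Vcinv[Uy _ cy]; have := fd _ Uy; rewrite cy => fdy.
  by eexists; exact: fdy.
have sG l : smmx l V G.
  move=> i j; have [/(smooth_vfP _ Uo)/(_ c l ca) sFi _] := sF i.
  have sFi' : smmx l V (local_rep c (fun y => row i (F y))).
    by apply: smmx_sub sFi => _ [y [[Uy _] cy] <-]; exists y.
  apply: (Cks_eq Vo _ (sFi' 0 j)) => y _.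
  by rewrite local_repE -row_mul mxE.
have sFJ l : smmx l V (fun y => F (cinv c y) *m J (cinv c y) *m T y).
  move=> i j; have [_ sJ _] := cJ.
  have /(smooth_vfP _ Uo)/(_ c l ca) sFi := sJ U _ Uo (sF i).
  have sFi' : smmx l V (local_rep c (fun y => row i (F y) *m J y)).
    by apply: smmx_sub sFi => _ [y [[Uy _] cy] <-]; exists y.
  apply: (Cks_eq Vo _ (sFi' 0 j)) => y _.
  by rewrite local_repE -!row_mul mxE.
have sJh l : smmx l V Jh.
  by apply: (smmxM Vo (sFJ l)); apply: smmx_sub (sL l).
have sW l : smmx l V W.
  apply: (smmxM Vo); last exact: smmx_tr.
  apply: (smmxM Vo) => //.
  have sth : smmx l.+1 V th by apply: smmx_sub (st l.+1).
  have sdt := smmx_jacobian Vo sth.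
  suff h : smmx l V (fun y => ('J th y)^T - 'J th y).
    by apply: (smmx_eq Vo _ h) => y _; rewrite dform.unlock.
  by apply: (smmxD Vo); [exact: smmx_tr|exact: smmxN].
have sA l : smmx l V (fun y => A_mx (W y) (Jh y)).
  apply: smmx_A_mx => // y /fdV[s fdy].
  have [_ [_ JJ _ _]] := fdy.
  exact: g_mx_unit JJ (nu_mx_unit fdy (nd _)).
have sK := smmx_imag_of Vo _ sA.
have {}sK : smmx k V (fun y => imag_of (A_mx (W y) (Jh y))).
  apply: sK => y /fdV[s fdy].
  exact: frame_no_real_root fdy (nd _) (nreal _).
have sXc : smmx k V (local_rep c X).
  move/(smooth_vfP _ U'o)/(_ c k ca): sX; apply: smmx_sub.
  by move=> _ [y [[_ U'y] cy] <-]; exists y.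
have sLV : smmx k V L by apply: smmx_sub (sL k).
(* In the chart c the field K X is the product X L k G: L reads off the coordinates of X in the
   frame, k is the matrix of K there, and G returns to the chart. *)
have h := smmxM Vo (smmxM Vo (smmxM Vo sXc sLV) sK) (sG k).
apply: (smmx_eq Vo _ h) => y Vy; have [s fdy] := fdV y Vy.
have [Uy U'y cy] := Vcinv y Vy; have [_ FHy] := FH _ Uy.
have [_ _ GL] := GtL _ Uy; rewrite cy -/(T y) -/(G y) in GL.
have := HX _ U'y; rewrite -FHy => /submxP[w XE].
have wE : local_rep c X y *m L y = w.
  by rewrite local_repE XE -/(T y) -(mulmxA w) -/(G y) -mulmxA GL mulmx1.
rewrite wE local_repE -/(T y) XE -(mulmxA w (F _)) (canonical_K_frame fdy reg).
by rewrite (mulmxA w) -(mulmxA _ (F _) (T y)).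
Qed.

Lemma canonical_K_partially_integrable M (H J : M -> 'M[R]_(n.*2.+1)) :
  regular_almost_CR H J -> partially_integrable_CR H (canonical_K H J).
Proof.
move=> reg; have [[dH cJ nd] ndo nreal] := reg.
have nuE x (u v : 'rV[R]_(n.*2.+1)) : (u <= H x)%MS -> (v <= H x)%MS ->
    eq_mod (H x) (nu H (canonical_K H J) x u v) (omega H x u v).
  move=> uH vH; have [F [s [W [Jh fd]]]] := regular_frame x reg.
  have [fdK KWK] := canonical_K_data reg fd.
  have [p ->] := frameP fd uH; have [q ->] := frameP fd vH.
  have [_ [_ _ _ omE]] := fd.
  have halfW : 2^-1 *: (W + W) = W.
    by rewrite scalerDr -scalerDl -[2^-1]div1r -splitr scale1r.
  by rewrite (frame_eq_mod fd) (nu_frame fdK) omE /nu_mx KWK halfW.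
split=> //; split=> //.
- split.
  + move=> x; have [F [s [W [Jh fd]]]] := regular_frame x reg.
    have [[rF FH _ _] _] := fd.
    by rewrite -(eqmxMr _ FH) (canonical_K_frame fd reg) -FH submxMl.
  + by move=> U X Uo sX; exact: canonical_K_smooth.
  + move=> x v vH; have [F [s [W [Jh fd]]]] := regular_frame x reg.
    have [[_ [FK KK _ _]] _] := canonical_K_data reg fd.
    have [p ->] := frameP fd vH.
    by rewrite -(mulmxA p) FK !mulmxA -mulmxA FK mulmxA -(mulmxA p) KK mulmxN mulmx1 mulNmx.
(* The form nu of K agrees with omega modulo H x, so its kernel is that of omega. *)
- move=> x u uH h; apply: (ndo x u uH) => v vH.
  have := nuE x u v uH vH; have := h v vH; rewrite /eq_mod subr0 => h1 h2.
  by rewrite subr0 -(subrK (nu H (canonical_K H J) x u v) (omega H x u v)) addmx_sub// -opprB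
    (eqmx_opp _).
Qed.

(** With F0 the pullback of a frame F at [phi x], the same W and Jh are frame data at both points,
    so K is given by the same matrix in F0 and in F. *)
Lemma canonical_K_natural (M M' : manifold R n.*2.+1)
    (H J : M -> 'M[R]_(n.*2.+1)) (H' J' : M' -> 'M[R]_(n.*2.+1)) (phi : M -> M') :
  regular_almost_CR H J -> regular_almost_CR H' J' -> diffeomorphism phi ->
  maps_distribution phi H H' -> intertwines phi H J J' ->
  intertwines phi H (canonical_K H J) (canonical_K H' J').
Proof.
move=> reg reg' dphi mH iJ x v vH.
have [[dH cJ nd] _ _] := reg; have [[dH' cJ' nd'] _ _] := reg'.
have sphi := dphi.1.
pose c := chart_at (phi x).
have ca : atlas c := chart_at_atlas _; have cx : cdom c (phi x) := chart_at_dom _.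
have [U [F [th [L [[Uo Ux Uc] sF FH stL GtL]]]]] := local_frame dH' ca cx.
have st k : smmx k (c @` U) th by case: (stL k).
have fd' := local_frame_data dH' cJ' ca Uo Uc FH st GtL Ux.
rewrite !(mjac_id cx) mul1mx !mulmx1 in fd'.
set W := _ *m _ *m _^T in fd'; set Jh := _ *m L _ in fd'.
pose T := tangent_map phi x.
have Tu : T \in unitmx by exact: tangent_map_unit.
pose F0 := F (phi x) *m invmx T.
have F0T : F0 *m T = F (phi x) by rewrite mulmxKV.
have [[rF FH' s0 Fs] [FJ JJ WT omE]] := fd'.
have F0H : (F0 :=: H x)%MS.
  have E : (H x *m T :=: H' (phi x))%MS by apply/eqmxP; exact: mH.
  have E2 : (F0 :=: H x *m T *m invmx T)%MS by apply: eqmxMr; exact: eqmx_trans FH' (eqmx_sym E).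
  by rewrite mulmxK in E2.
have rF0 : row_free F0 by rewrite /row_free mxrankMfree// row_free_unit unitmx_inv.
clearbody F0.
have fd : frame_data H J x F0 (T *m (th (c (phi x)))^T) W Jh.
  split; split=> //.
  - apply: contraNneq s0 => /(congr1 (mulmx (invmx T))).
    by rewrite mulKmx// mulmx0 => ->.
  - by rewrite mulmxA F0T.
  - have F0J : F0 *m J x *m T = F0 *m T *m J' (phi x).
      apply/row_matrixP => i; rewrite !row_mul; apply: iJ.
      by rewrite -F0H row_sub.
    by rewrite -[LHS](mulmxK Tu) F0J F0T FJ -F0T (mulmxA Jh) mulmxK.
  - move=> p q.
    have inH (w : 'rV[R]_(n.*2)) : (w *m F0 <= H x)%MS by rewrite -F0H submxMl.
    have dt : differentiable th (c (phi x)).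
      by apply: (smmx_differentiable (st 1)); exists (phi x).
    have ann : \forall z \near x, forall w : 'rV[R]_(n.*2.+1), (w <= H z)%MS ->
        w *m mjac (chart_at z) c phi z *m (th (c (phi z)))^T = 0.
      have nU : \forall z \near x, U (phi z) by apply: sphi.1; exact: open_nbhs_nbhs.
      apply: (@filterS _ (nbhs x) _ _ _ _ nU) => z Uz w wH.
      have cz := Uc _ Uz.
      have := mjac_comp sphi (smooth_map_id M') (chart_at_atlas z) (chart_at_atlas (phi z)) ca
        (chart_at_dom z) (chart_at_dom (phi z)) cz.
      rewrite -tangent_mapE => ->.
      have [_ FHz] := FH _ Uz; have [Gz _ _] := GtL _ Uz.
      have : (w *m tangent_map phi z <= F (phi z))%MS.
        rewrite FHz; have /andP[h _] := mH z.
        by apply: submx_trans h; exact: submxMr.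
      by move=> /submxP[w' E]; rewrite mulmxA E -(mulmxA w') -mulmxA Gz mulmx0.
    (* Applied to phi itself with a 1-form on the target, so no vector field has to be pushed
       forward. *)
    have := omega_dform dH sphi ca cx dt ann (inH p) (inH q).
    rewrite -tangent_mapE -/T -!(mulmxA _ F0 T) F0T => E.
    by rewrite mulmxA E trmx_mul /W !mulmxA.
have [p ->] := frameP fd vH.
rewrite -!(mulmxA p) (canonical_K_frame fd reg) -mulmxA F0T.
by rewrite (canonical_K_frame fd' reg').
Qed.

End Main.

Theorem theorem2p2 (R : realType) :
  exists K : forall (n : nat) (M : manifold R n.*2.+1),
      (M -> 'M[R]_(n.*2.+1)) -> (M -> 'M[R]_(n.*2.+1)) -> M -> 'M[R]_(n.*2.+1),
    (forall (n : nat) (M : manifold R n.*2.+1) (H J : M -> 'M[R]_(n.*2.+1)),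
       regular_almost_CR H J -> partially_integrable_CR H (K n M H J)) /\
    (forall (n : nat) (M M' : manifold R n.*2.+1)
            (H J : M -> 'M[R]_(n.*2.+1)) (H' J' : M' -> 'M[R]_(n.*2.+1))
            (phi : M -> M'),
       regular_almost_CR H J -> regular_almost_CR H' J' ->
       diffeomorphism phi -> maps_distribution phi H H' ->
       intertwines phi H J J' ->
       intertwines phi H (K n M H J) (K n M' H' J')).
Proof.
exists (fun n M H J => canonical_K H J); split.
  by move=> n M H J; exact: canonical_K_partially_integrable.
by move=> n M M' H J H' J' phi; exact: canonical_K_natural.
Qed.
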